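(* Let $d\ge1$, let $\mathcal V_{d,1}\subset\mathbb P^d_{\mathbb C}$ be the complex rational normal curve parametrized by $[x_0:x_1]\mapsto[x_0^d:x_0^{d-1}x_1:\cdots:x_0x_1^{d-1}:x_1^d]$, and let $Q$ be a nondegenerate symmetric bilinear form on $\mathbb R^{d+1}\cong S^dV^{\mathbb R}$ ($\dim V^{\mathbb R}=2$) with associated real symmetric matrix $M_Q$. If $M_Q$ is positive definite, then $\mathrm{EDdefect}_Q(\mathcal V_{d,1})$ is an even integer. Furthermore, if $\mathrm{EDdefect}_Q(\mathcal V_{d,1})\ge 2d-1$, then $M_Q$ cannot be real positive definite.
   Context: $Q$ is extended complex bilinearly to $W=\mathbb C^{d+1}$, and $q(x)=Q(x,x)$. For a projective variety $X\subset\mathbb P(W)$ with affine cone $CX\subset W$, and $x\in(CX)_{\mathrm{sm}}$, put $N_xCX=\{v^*\in W: Q(v^*,v)=0\ \forall v\in T_xCX\}$. The ED correspondence $\mathcal E(X,Q)$ is the Zariski closure of $\{(x,u)\in W\times W: x\in(CX)_{\mathrm{sm}},\ u-x\in N_xCX\}$, and $\mathrm{EDdegree}_Q(X)$ is the cardinality of the fiber of its second projection to $W$ over a general $u\in W$ (equal to $0$ if this projection is not dominant, e.g. if $X\subset\{q=0\}$). The generic ED degree $\mathrm{gEDdegree}(X)$ is the value of $\mathrm{EDdegree}_{Q'}(X)$ for a generic nondegenerate symmetric bilinear form $Q'$ on $W$, and $\mathrm{EDdefect}_Q(X)=\mathrm{gEDdegree}(X)-\mathrm{EDdegree}_Q(X)$.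 *)

(* Defs.v *)
From mathcomp Require Import all_boot all_order all_algebra.
From mathcomp Require Import boolp classical_sets functions cardinality reals.
From mathcomp Require Import complex mpoly.

Set Implicit Arguments.
Unset Strict Implicit.
Unset Printing Implicit Defensive.

Import GRing.Theory Num.Theory.

Local Open Scope classical_set_scope.
Local Open Scope card_scope.
Local Open Scope ring_scope.

(* An irreducible projective variety X in P(W), with W = K^n, is represented
   throughout by its affine cone CX, a set of row vectors. *)

Section AffineZariski.
Variables (K : fieldType) (n : nat).
Implicit Types (X S : set 'rV[K]_n) (x u v : 'rV[K]_n).

Definition vanishing_ideal X : set {mpoly K[n]} :=
  [set f | forall x, X x -> f.@[x 0] = 0].

Definition zariski_closure X : set 'rV[K]_n :=
  [set x | forall f, vanishing_ideal X f -> f.@[x 0] = 0].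

(* P holds for a general point of S: on the trace on S of some basic open set
   g != 0 which meets S. *)
Definition general_in S (P : 'rV[K]_n -> Prop) : Prop :=
  exists2 g : {mpoly K[n]},
    (exists2 u, S u & g.@[u 0] != 0) &
    (forall u, S u -> g.@[u 0] != 0 -> P u).

(* The classes of f_0, ..., f_(r-1) in the coordinate ring of X are
   algebraically independent over K. *)
Definition alg_indep_on X r (f : 'I_r -> {mpoly K[n]}) : Prop :=
  forall g : {mpoly K[r]},
    (forall x, X x -> g.@[fun i => (f i).@[x 0]] = 0) -> g = 0.

(* The dimension of an irreducible closed X is the transcendence degree over K
   of its function field, which is already attained inside the coordinate
   ring. *)
Definition has_dimension X (r : nat) : Prop :=
  (exists f : 'I_r -> {mpoly K[n]}, alg_indep_on X f) /\
  ~ (exists f : 'I_r.+1 -> {mpoly K[n]}, alg_indep_on X f).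

(* Zariski tangent space, as a linear subspace (not translated to x). *)
Definition tangent_space X x : set 'rV[K]_n :=
  [set v | forall f, vanishing_ideal X f ->
     \sum_(i < n) (f^`M(i)).@[x 0] * v 0 i = 0].

Definition smooth_locus X : set 'rV[K]_n :=
  [set x | X x /\
     exists2 T : {vspace 'rV[K]_n}, has_dimension X (\dim T) &
       forall v, v \in T <-> tangent_space X x v].

End AffineZariski.

Section EDdegree.
Variables (K : fieldType) (n : nat).
Implicit Types (X : set 'rV[K]_n) (Q : 'rV[K]_n -> 'rV[K]_n -> K).

Definition normal_space Q X (x : 'rV[K]_n) : set 'rV[K]_n :=
  [set w | forall v, tangent_space X x v -> Q w v = 0].

(* W x W is identified with K^(n + n) by (x, u) |-> row_mx x u. *)
Definition ED_correspondence Q X : set ('rV[K]_n * 'rV[K]_n) :=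
  [set p | zariski_closure
     [set row_mx z.1 z.2 | z in
        [set z : 'rV[K]_n * 'rV[K]_n |
           smooth_locus X z.1 /\ normal_space Q X z.1 (z.2 - z.1)]]
     (row_mx p.1 p.2)].

(* When the second projection is not dominant the general fiber is empty, so
   that k = 0. *)
Definition is_EDdegree Q X (k : nat) : Prop :=
  general_in setT (fun u => [set x | ED_correspondence Q X (x, u)] #= `I_k).

(* There is at most one such k when K is infinite; 0 is a default value in
   case there is none. *)
Definition EDdegree Q X : nat := xget 0%N [set k | is_EDdegree Q X k].

(* Bilinear forms on W are the points of K^(n * n), through their matrices. *)
Definition nondeg_sym_forms : set 'rV[K]_(n * n) :=
  [set mxvec M | M in [set M : 'M[K]_n | M \is symmetricmx /\ M \in unitmx]].

Definition is_gEDdegree X (k : nat) : Prop :=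
  general_in nondeg_sym_forms
    (fun w => is_EDdegree (form_of_matrix idfun (vec_mx w : 'M[K]_n)) X k).

Definition gEDdegree X : nat := xget 0%N [set k | is_gEDdegree X k].

Definition EDdefect Q X : int := (gEDdegree X)%:Z - (EDdegree Q X)%:Z.

End EDdegree.

Definition veronese (K : fieldType) (d : nat) (a b : K) : 'rV[K]_d.+1 :=
  \row_(i < d.+1) (a ^+ (d - i) * b ^+ i).

Definition rational_normal_cone (K : fieldType) (d : nat) : set 'rV[K]_d.+1 :=
  [set v | exists c a b : K, (a, b) != (0, 0) /\ v = c *: veronese d a b].

(* C-bilinear extension to C^n of a real bilinear form on R^n. *)
Definition complexify (R : realType) (n : nat)
    (Q : 'rV[R]_n -> 'rV[R]_n -> R) : 'rV[R[i]]_n -> 'rV[R[i]]_n -> R[i] :=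
  form_of_matrix idfun (map_mx (real_complex R) (matrix_of_form Q)).

Definition posdefmx (R : realType) (n : nat) (M : 'M[R]_n) : Prop :=
  forall x : 'rV[R]_n, x != 0 -> 0 < (x *m M *m x^T) 0 0.

(* Main.v *)
Require Import Defs.
From mathcomp Require Import all_boot all_order all_algebra.
From mathcomp Require Import separable cyclotomic.
From mathcomp Require Import boolp classical_sets functions cardinality reals.
From mathcomp Require Import complex mpoly zify ring.

(** Why the proposition holds.  Write v(s) = (1, s, ..., s^d) for the affine
    part of the curve, M for the Gram matrix of Q, f(s) = Q(v(s), v(s)), of
    degree at most 2d, and l_u(s) = Q(u, v(s)), of degree at most d.  The point
    c v(s) of the cone, with c nonzero, is critical for u exactly when
    l_u(s) = c f(s) and 2 l_u'(s) = c f'(s).  Eliminating c, s is a root of the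
    Jacobian l_u f' - 2 l_u' f, which for a general u has degree 3d - 2.  All of
    these Jacobians are divisible by gcd(f, f'), whose roots are spurious: there
    f and f' vanish, whereas l_u does not.  The remaining factor is the critical
    polynomial l_u p - 2 l_u' w, where p / w is f' / f in lowest terms.  For a
    general u it is separable and prime to f and to l_u, so that
      EDdegree = 3d - 2 - deg gcd(f, f') = d - 2 + (number of roots of f)
    as soon as f has degree 2d ([EDdegree_rnc]).

    Three points need care.
    - Separability of a general critical polynomial ([generic_witness]) is a
      Bertini argument in the pencil l = (X - b)^d + t: a multiple root of
      A + t B is a root of the Wronskian of A and B, which leaves finitely many
      values of t ([pencil_separable]).
    - The ED correspondence is a Zariski closure, so that its fibre over u
      could be larger than the set of critical points.  The closure still
      satisfies the equations Q(u - x, x S) = 0 for the linear vector fields S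
      tangent to the cone ([ED_field]), and these force criticality away from
      x = 0.  The vertex is excluded by the resultant of the critical
      polynomial with x_0 f - l_u ([ED_origin]): it vanishes on all critical
      pairs, but not at (0, u) for a general u.
    - Smoothness refers to the dimension of the cone, the transcendence degree
      of its function field.  It is 2 because there are more monomials in three
      polynomials in two variables than the space that contains them allows
      ([three_dependent]).

    For a general form, f has 2d simple roots: this is an open condition, and
    it holds for M = 1, where f = (X^(2d+2) - 1) / (X^2 - 1).  Hence the generic
    ED degree is 3d - 2 ([gEDdegree_rnc]), and the defect is
    2d - (number of roots of f).  If M is real positive definite, f has degree
    2d, real coefficients and no real root, so that its roots form conjugate
    pairs ([conj_closed_even]).  Their number is even and positive, whence the
    defect is even and at most 2d - 2. *)

Set Implicit Arguments.
Unset Strict Implicit.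
Unset Printing Implicit Defensive.

Import Order.TTheory GRing.Theory Num.Theory.

Local Open Scope classical_set_scope.
Local Open Scope card_scope.
Local Open Scope ring_scope.

(** * Polynomials on an infinite field *)

Lemma infinite_nonroot (K : numDomainType) (Z : {poly K}) :
  Z != 0 -> exists t, Z.[t] != 0.
Proof.
move=> nz; pose s := [seq i%:R : K | i <- iota 0 (size Z)].
have us : uniq s.
  by rewrite map_inj_uniq ?iota_uniq // => i j /eqP; rewrite eqr_nat => /eqP.
case: (boolP (all (root Z) s)) => [rs|/allPn[t _ nt]].
  by have := max_poly_roots nz rs us; rewrite size_map size_iota ltnn.
by exists t.
Qed.

Lemma poly_vanish (K : numDomainType) (Z : {poly K}) :
  (forall t, Z.[t] = 0) -> Z = 0.
Proof.
move=> Z0; apply/eqP; apply/negP => /negP /infinite_nonroot[t].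
by rewrite Z0 eqxx.
Qed.

(** Sorting the monomials by their exponent in the last variable reduces the
    claim to one variable fewer: for fixed values of the other variables the
    polynomial in the last one vanishes identically, hence so do its
    coefficients. *)
Lemma mpoly_vanish (K : numDomainType) n (g : {mpoly K[n]}) :
  (forall v : 'I_n -> K, g.@[v] = 0) -> g = 0.
Proof.
elim: n g => [|n IH] g g0.
  by rewrite (nvar0_mpolyC g); have := g0 (fun=> 0); rewrite {1}(nvar0_mpolyC g) mevalC => ->.
have lastE (i : 'I_n.+1) : (exists j : 'I_n, i = widen_ord (leqnSn n) j) \/ i = ord_max.
  case: (ltnP i n) => h; [left; exists (Ordinal h); exact: val_inj|right; apply: val_inj => /=].
  by have := ltn_ord i; lia.
pose q k := \sum_(m <- msupp g | m ord_max == k)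
              g@_m *: 'X_[[multinom m (widen_ord (leqnSn n) i) | i < n]].
have q0 k : q k = 0.
  apply: IH => v.
  pose P := \sum_(m <- msupp g)
     (g@_m * \prod_(i < n) v i ^+ m (widen_ord (leqnSn n) i)) *: 'X^(m ord_max).
  have -> : (q k).@[v] = P`_k.
    rewrite /q raddf_sum coef_sum big_mkcond /=; apply: eq_bigr => m _.
    rewrite coefZ coefXn eq_sym; case: eqP => _; last by rewrite mulr0.
    rewrite mulr1 mevalZ mevalX; congr (_ * _).
    by apply: eq_bigr => i _; rewrite mnmE.
  suff -> : P = 0 by rewrite coef0.
  apply: poly_vanish => t.
  pose v' i := oapp v t (insub (i : nat) : option 'I_n).
  rewrite -(g0 v') mevalE horner_sum; apply: eq_bigr => m _.
  rewrite hornerZ hornerXn -mulrA; congr (_ * _).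
  rewrite big_ord_recr /=; congr (_ * _ ^+ _); last by rewrite /v' insubN //= ltnn.
  by apply: eq_bigr => i _; rewrite /v' /= valK.
apply/mpolyP => m; rewrite mcoeff0.
have := congr1 (mcoeff [multinom m (widen_ord (leqnSn n) i) | i < n]) (q0 (m ord_max)).
rewrite mcoeff0 /q raddf_sum /= => <-.
case: (boolP (m \in msupp g)) => [ms|ms].
  rewrite big_mkcond (bigD1_seq m) //= ?msupp_uniq // eqxx mcoeffZ mcoeffX eqxx mulr1.
  rewrite big1 ?addr0 // => m' ne; case: eqP => // e1; rewrite mcoeffZ mcoeffX.
  case: eqP => [/mnmP e|_]; last by rewrite mulr0.
  case/eqP: ne; apply/mnmP => i; case: (lastE i) => [[j ->]|->] //.
  by have := e j; rewrite !mnmE.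
rewrite (memN_msupp_eq0 ms) big1_seq // => m' /andP[/eqP e1 m's].
rewrite mcoeffZ mcoeffX; case: eqP => [/mnmP e|_]; last by rewrite mulr0.
case/negP: ms; suff -> : m = m' by [].
apply/mnmP => i; case: (lastE i) => [[j ->]|->] //.
by have := e j; rewrite !mnmE.
Qed.

(** * Polynomials along a polynomial curve *)

Section Curve.
Variables (K : comNzRingType) (n : nat) (g : 'I_n -> {poly K}).

Definition along (f : {mpoly K[n]}) : {poly K} := mmap polyC g f.

Lemma alongE f t : (along f).[t] = f.@[fun i => (g i).[t]].
Proof.
rewrite /along /mmap mevalE horner_sum; apply: eq_bigr => m _.
rewrite hornerM hornerC; congr (_ * _); rewrite /mmap1 horner_prod.
by apply: eq_bigr => i _; rewrite horner_exp.
Qed.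

(** Chain rule: both sides are derivations in [f], so that it suffices to
    compare them on constants and variables. *)
Lemma deriv_along f :
  (along f)^`() = \sum_(i < n) along f^`M(i) * (g i)^`().
Proof.
pose P f := (along f)^`() = \sum_(i < n) along f^`M(i) * (g i)^`().
have PC c : P c%:MP.
  rewrite /P /along mmapC derivC big1 // => i _.
  by rewrite mderivC mmap0 mul0r.
have PD f1 f2 : P f1 -> P f2 -> P (f1 + f2).
  rewrite /P /along => e1 e2; rewrite mmapD derivD e1 e2 -big_split /=.
  by apply: eq_bigr => i _; rewrite mderivD mmapD mulrDl.
have PM f1 f2 : P f1 -> P f2 -> P (f1 * f2).
  rewrite /P /along => e1 e2; rewrite rmorphM /= derivM e1 e2.
  rewrite mulr_suml mulr_sumr -big_split /=; apply: eq_bigr => i _.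
  by rewrite mderivM mmapD !rmorphM /=; ring.
have PX i : P 'X_i.
  rewrite /P /along mmapX mmap1U (bigD1 i) //= mderivX mnm1E eqxx scale1r.
  have -> : (U_(i) - U_(i))%MM = 0%MM :> 'X_{1..n}.
    by apply/mnmP => j; rewrite mnmBE subnn mnm0E.
  rewrite mpolyX0 rmorph1 mul1r big1 ?addr0 // => j ne.
  by rewrite mderivX mnm1E eq_sym (negbTE ne) scale0r mmap0 mul0r.
have Pexp f1 k : P f1 -> P (f1 ^+ k).
  by move=> h; elim: k => [|k IH]; [rewrite expr0; exact: PC|rewrite exprS; apply: PM].
elim/mpolyind: f => [|c m p _ _ Pp]; first exact: (PC 0).
apply: PD => //; rewrite -mul_mpolyC; apply: (PM _ _) => //; rewrite mpolyXE_id.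
by apply: (big_ind P) => [||i _]; [exact: (PC 1)|exact: PM|exact: Pexp].
Qed.

End Curve.

(** * Sylvester matrices in prescribed formal degrees *)

Section Sylvester.

(** The degrees [m] and [n] are parameters, not computed from [p] and [q]: the
    determinant then commutes with every specialization of the coefficients,
    even when a leading coefficient vanishes. *)
Definition sylv (R : comNzRingType) m n (p q : {poly R}) : 'M[R]_(n + m) :=
  \matrix_(i, j) match fintype.split i with
                 | inl k => (p * 'X^k)`_j
                 | inr k => (q * 'X^k)`_j
                 end.

Lemma map_sylv (R S : comNzRingType) (phi : {rmorphism R -> S}) m n (p q : {poly R}) :
  map_mx phi (sylv m n p q) = sylv m n (map_poly phi p) (map_poly phi q).
Proof.
apply/matrixP => i j; rewrite !mxE; case: (fintype.split i) => k;
by rewrite -coef_map rmorphM /= map_polyXn.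
Qed.

Variable K : fieldType.
Implicit Types p q : {poly K}.

(** The powers of a common root form a kernel vector.  The condition [0 < n]
    excludes the matrix of size 0, whose determinant is 1. *)
Lemma sylv_common_root m n p q s :
  (0 < n)%N -> (size p <= m.+1)%N -> (size q <= n.+1)%N ->
  root p s -> root q s -> \det (sylv m n p q) = 0.
Proof.
move=> n0 sp sq /eqP ps /eqP qs; apply/eqP; apply/negP => /negP nz.
have U : sylv m n p q \in unitmx by rewrite unitmxE unitfE.
pose v : 'cV[K]_(n + m) := \col_j s ^+ j.
have ev (r : {poly K}) : (size r <= n + m)%N -> \sum_(j < n + m) r`_j * s ^+ j = r.[s].
  by move=> sr; rewrite (horner_coef_wide _ sr).
have sX (r : {poly K}) a b (k : 'I_a) :
    (size r <= b.+1)%N -> (size (r * 'X^k)%R <= a + b)%N.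
  move=> sr; apply: leq_trans (size_polyMleq _ _) _; rewrite size_polyXn.
  by have := ltn_ord k; lia.
have v0 : sylv m n p q *m v = 0.
  apply/colP => i; rewrite mxE [RHS]mxE.
  under eq_bigr do rewrite !mxE.
  case: (fintype.split i) => k; rewrite ev ?hornerM ?ps ?qs ?mul0r ?sX //.
  by rewrite addnC sX.
have : v = 0 by rewrite -[v](mulKmx U) v0 mulmx0.
have nm : (0 < n + m)%N by rewrite addn_gt0 n0.
move/colP => /(_ (Ordinal nm)); rewrite !mxE expr0 => /eqP.
by rewrite oner_eq0.
Qed.

(** A kernel vector is a relation [a * p + b * q = 0] with [size b <= m]; as
    [p] is prime to [q], it divides [b], which is too small.  Only [p] has to
    reach its formal degree. *)
Lemma sylv_coprime m n p q :
  size p = m.+1 -> (size q <= n.+1)%N -> coprimep p q ->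
  \det (sylv m n p q) != 0.
Proof.
move=> sp sq cop; apply/negP => /det0P[v nv v0].
pose a := rVpoly (lsubmx v); pose b := rVpoly (rsubmx v).
have ca (k : 'I_n) : a`_k = v 0 (lshift m k) by rewrite /a coef_rVpoly_ord mxE.
have cb (k : 'I_m) : b`_k = v 0 (rshift n k) by rewrite /b coef_rVpoly_ord mxE.
have pn0 : p != 0 by rewrite -size_poly_eq0 sp.
have ab0 : a * p + b * q = 0.
  have sa : (size (a * p)%R <= n + m)%N.
    apply: leq_trans (size_polyMleq _ _) _; rewrite sp.
    by rewrite addnS leq_add2r size_poly.
  have sb : (size (b * q)%R <= n + m)%N.
    apply: leq_trans (size_polyMleq _ _) _.
    by rewrite -subn1 leq_subLR add1n -addSn addnC leq_add // size_poly.
  apply/polyP => j; rewrite coef0; case: (ltnP j (n + m)) => hj; last first.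
    by rewrite nth_default // (leq_trans (size_polyD _ _)) // geq_max !(leq_trans _ hj).
  have := congr1 (fun w : 'rV_(n + m) => w 0 (Ordinal hj)) v0.
  rewrite !mxE => e0; apply: etrans e0; rewrite big_split_ord /= coefD; congr (_ + _).
    rewrite -[a]coefK poly_def mulr_suml coef_sum.
    rewrite (big_ord_widen n (fun k => (a`_k *: 'X^k * p)`_j)) ?size_poly //.
    rewrite [LHS]big_mkcond; apply: eq_bigr => k _; rewrite !mxE (unsplitK (inl k)).
    rewrite -scalerAl coefZ [p * _]mulrC.
    by rewrite -ca; case: ltnP => // h; rewrite nth_default ?mul0r.
  rewrite -[b]coefK poly_def mulr_suml coef_sum.
  rewrite (big_ord_widen m (fun k => (b`_k *: 'X^k * q)`_j)) ?size_poly //.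
  rewrite [LHS]big_mkcond; apply: eq_bigr => k _; rewrite !mxE (unsplitK (inr k)).
  rewrite -scalerAl coefZ [q * _]mulrC.
  by rewrite -cb; case: ltnP => // h; rewrite nth_default ?mul0r.
have b0 : b = 0.
  apply/eqP; apply/negP => /negP bn0.
  have : p %| b * q.
    by rewrite (_ : b * q = - (a * p)) ?dvdpNr ?dvdp_mull //; apply/eqP; rewrite -addr_eq0 addrC ab0.
  rewrite Gauss_dvdpl // => /(dvdp_leq bn0); rewrite sp => h.
  by have := leq_trans h (size_poly _ _); rewrite ltnn.
have a0 : a = 0.
  by move/eqP: ab0; rewrite b0 mul0r addr0 mulf_eq0 (negbTE pn0) orbF => /eqP.
case/eqP: nv; rewrite -[v]hsubmxK -[lsubmx v]rVpolyK -[rsubmx v]rVpolyK -/a -/b a0 b0.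
by rewrite !linear0 row_mx0.
Qed.

End Sylvester.

(** * Critical polynomials in one variable *)

(** For [p] and [w] the derivative of a form of degree [2 d] and the form itself,
    and [l] a form of degree [d], this is the Jacobian determinant of the two
    binary forms, divided by [d] and dehomogenized. *)
Definition jac (R : nzRingType) (p w l : {poly R}) : {poly R} :=
  l * p - (l^`() * w) *+ 2.

Lemma map_jac (R S : nzRingType) (phi : {rmorphism R -> S}) p w l :
  map_poly phi (jac p w l) =
  jac (map_poly phi p) (map_poly phi w) (map_poly phi l).
Proof. by rewrite /jac rmorphB rmorphMn !rmorphM /= deriv_map. Qed.

Section JacCoef.
Variable R : comNzRingType.
Implicit Types f l : {poly R}.

(** The factor [k.+1 - 3 i] is [j - 2 i] for [i + j = k.+1].  It vanishes at
    [i = d], [j = d.*2], so that the top coefficient of the Jacobian cancels. *)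
Lemma coef_jac_deriv f l k :
  (jac f^`() f l)`_k =
  \sum_(i < k.+2) (l`_i * f`_(k.+1 - i) *+ k.+1 - l`_i * f`_(k.+1 - i) *+ (i * 3)).
Proof.
have e1 : (l * f^`())`_k = \sum_(i < k.+2) l`_i * f`_(k.+1 - i) *+ (k.+1 - i).
  rewrite coefM [RHS]big_ord_recr /= subnn mulr0n addr0; apply: eq_bigr => i _.
  have lei : (i <= k)%N by have := ltn_ord i; lia.
  by rewrite coef_deriv subSn // mulrnAr.
have e2 : (l^`() * f)`_k = \sum_(i < k.+2) l`_i * f`_(k.+1 - i) *+ i.
  rewrite coefM [RHS]big_ord_recl /= mulr0n add0r; apply: eq_bigr => i _.
  by rewrite coef_deriv /bump add1n subSS mulrnAl.
rewrite coefB coefMn e1 e2 -sumrMnl -sumrB; apply: eq_bigr => i _.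
have lei : (i <= k.+1)%N by have := ltn_ord i; lia.
set x := l`_i * _; rewrite mulrnBr // mulrnA.
by move: (x *+ k.+1) (x *+ i) => a b; ring.
Qed.

(** The coefficient of degree [3 d - 2] of the Jacobian; it vanishes exactly
    when the Jacobian has a root at infinity. *)
Definition jaclead f d l : R :=
  l`_d.-1 * f`_d.*2 *+ 2 - l`_d * f`_d.*2.-1.

Variables (f l : {poly R}) (d : nat).
Hypotheses (d0 : (0 < d)%N) (sf : (size f <= d.*2.+1)%N) (sl : (size l <= d.+1)%N).

Lemma size_jac_deriv : (size (jac f^`() f l) <= (d * 3).-1)%N.
Proof.
apply/leq_sizeP => k hk; rewrite coef_jac_deriv big1 // => i _.
case: (ltnP d i) => hi; first by rewrite (nth_default 0 (leq_trans sl hi)) !mul0r !mul0rn subrr.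
case: (ltnP d.*2 (k.+1 - i)) => hj.
  by rewrite (nth_default 0 (leq_trans sf hj)) mulr0 !mul0rn subrr.
have [-> ->] : (i = d :> nat) /\ k.+1 = (d * 3)%N by split; lia.
by rewrite subrr.
Qed.

Lemma coef_jac_lead : (jac f^`() f l)`_(d * 3).-2 = jaclead f d l.
Proof.
rewrite coef_jac_deriv /jaclead.
have h1 : ((d.-1) < (d * 3).-2.+2)%N by lia.
have h2 : (d < (d * 3).-2.+2)%N by lia.
rewrite (bigD1 (Ordinal h1)) //= (bigD1 (Ordinal h2)) /=; last first.
  by rewrite -val_eqE /=; lia.
rewrite big1 ?addr0 => [|i /andP[]]; last first.
  rewrite -!val_eqE /= => ne1 ne2.
  case: (ltnP d i) => hi; first by rewrite (nth_default 0 (leq_trans sl hi)) !mul0r !mul0rn subrr.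
  by rewrite (nth_default 0 (leq_trans sf _)) ?mulr0 ?mul0rn ?subrr //; lia.
have -> : ((d * 3).-2.+1 - d.-1 = d.*2)%N by lia.
have -> : ((d * 3).-2.+1 - d = d.*2.-1)%N by lia.
have -> : ((d * 3).-2.+1 = d.-1 * 3 + 2)%N by lia.
have -> : (d * 3 = d.-1 * 3 + 3)%N by lia.
set x := l`_d * _; set y := l`_d.-1 * _; rewrite !mulrnDr.
by move: (x *+ _) (y *+ _) => a b; ring.
Qed.

End JacCoef.

Lemma size_num_deriv (R : numDomainType) (p : {poly R}) :
  size p^`() = (size p).-1.
Proof.
have [->|p0] := eqVneq p 0; first by rewrite deriv0 size_poly0.
apply/eqP; rewrite eqn_leq -ltnS prednK ?lt_size_deriv ?lt0n ?size_poly_eq0 //=.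
case sp : (size p) => [|[|n]] //=; apply: contraTT (oner_neq0 R) => h.
have : p^`()`_n = 0 by rewrite nth_default // -ltnS ltnNge.
rewrite coef_deriv => /eqP; rewrite mulrn_eq0 /= => h0.
by move: p0; rewrite -lead_coef_eq0 lead_coefE sp /= h0.
Qed.

Section Reduced.
Variable K : fieldType.
Implicit Types f l : {poly K}.

(** [dlog_num f / sqfree f] is the logarithmic derivative of [f] in lowest
    terms; [sqfree f] has the roots of [f], each with multiplicity one. *)
Definition sqfree f := f %/ gcdp f f^`().
Definition dlog_num f := f^`() %/ gcdp f f^`().

Lemma sqfreeM f : f = sqfree f * gcdp f f^`().
Proof. by rewrite /sqfree divpK // dvdp_gcdl. Qed.

Lemma dlog_numM f : f^`() = dlog_num f * gcdp f f^`().
Proof. by rewrite /dlog_num divpK // dvdp_gcdr. Qed.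

Lemma coprime_sqfree_dlog_num f : f != 0 -> coprimep (sqfree f) (dlog_num f).
Proof. by move=> f0; apply: coprimep_div_gcd; rewrite f0. Qed.

Lemma jac_deriv f l : jac f^`() f l = jac (dlog_num f) (sqfree f) l * gcdp f f^`().
Proof.
have -> : jac (dlog_num f) (sqfree f) l * gcdp f f^`() =
          jac (dlog_num f * gcdp f f^`()) (sqfree f * gcdp f f^`()) l.
  by rewrite /jac; ring.
by rewrite -dlog_numM -sqfreeM.
Qed.

End Reduced.

Section Complex.
Variable K : numClosedFieldType.
Implicit Types f l : {poly K}.

(** At a root of multiplicity [m] the derivative has multiplicity [m - 1], as
    the characteristic is zero, hence so has the gcd. *)
Lemma root_sqfree f s : f != 0 -> root (sqfree f) s = root f s.
Proof.
move=> f0; apply/idP/idP => [ws|fs]; first by rewrite [f]sqfreeM rootM ws.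
have [m [g gs fE]] : exists m, exists2 g, ~~ root g s & f = g * ('X - s%:P) ^+ m.
  by have [m [g h1 h2]] := multiplicity_XsubC f s; exists m, g => //; move: h1; rewrite f0.
case: m fE => [|m] fE; first by case/negP: gs; move: fs; rewrite fE expr0 mulr1.
have e : sqfree f * f^`() = f * dlog_num f.
  transitivity (sqfree f * (dlog_num f * gcdp f f^`())); first by rewrite -dlog_numM.
  by transitivity ((sqfree f * gcdp f f^`()) * dlog_num f); [ring|rewrite -sqfreeM].
have : sqfree f * (g^`() * ('X - s%:P) + g *+ m.+1) = g * ('X - s%:P) * dlog_num f.
  have nz : ('X - s%:P) ^+ m != 0 :> {poly K} by rewrite expf_neq0 // polyXsubC_eq0.
  apply: (mulIf nz); transitivity (sqfree f * f^`()); last first.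
    by rewrite e {1}fE exprS; ring.
  have -> : f^`() = (g^`() * ('X - s%:P) + g *+ m.+1) * ('X - s%:P) ^+ m.
    by rewrite fE derivM deriv_exp derivXsubC mul1r /= exprS -mulr_natr; ring.
  by rewrite mulrA.
move/(congr1 (horner^~ s)); rewrite !hornerE subrr !(mulr0, mul0r, add0r).
move/eqP; rewrite mulf_eq0 hornerMn mulrn_eq0 /= => /orP[//|h].
by case/negP: gs.
Qed.

Lemma coprimepP_root f l :
  f != 0 -> (forall s, root f s -> ~~ root l s) -> coprimep f l.
Proof.
move=> f0 h; rewrite /coprimep; apply/negP => /negP/closed_rootP[s].
by rewrite root_gcd => /andP[/h /negP].
Qed.

(** At a multiple root [z] of [f + t *: l] the Wronskian of [f] and [l]
    vanishes, and [t] is determined by [z] since [l] does not vanish there.  The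
    Wronskian of coprime polynomials is zero only if both are constant. *)
Lemma pencil_separable f l : coprimep f l ->
  exists2 Z : {poly K}, Z != 0 &
    forall t, Z.[t] != 0 -> separable_poly (f + t *: l).
Proof.
move=> cop; pose W := f^`() * l - f * l^`().
have [W0|W0] := eqVneq W 0.
  have cst (a b : {poly K}) : coprimep a b -> a^`() * b = a * b^`() -> (size a <= 1)%N.
    move=> cab e; rewrite leqNgt; apply/negP => sa.
    have a'0 : a^`() != 0 by rewrite -size_poly_eq0 size_num_deriv; case: (size a) sa => [|[]].
    have : a %| a^`() by rewrite -(Gauss_dvdpl _ cab) e dvdp_mulr.
    move/(dvdp_leq a'0); rewrite size_num_deriv; case: (size a) sa => // n _.
    by rewrite ltnn.
  have e : f^`() * l = f * l^`() by apply/eqP; rewrite -subr_eq0 -/W W0.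
  have /size1_polyC fE := cst _ _ cop e.
  have /size1_polyC lE : (size l <= 1)%N.
    by apply: (cst _ f); [rewrite coprimep_sym|rewrite mulrC -e mulrC].
  exists ((f`_0)%:P + l`_0 *: 'X).
    apply/negP => /eqP/polyP e0; have := e0 0%N; have := e0 1%N.
    rewrite !coefD !coefZ !coefX !coefC /= add0r mulr1 mulr0 addr0 => l0 f0'.
    by move: cop; rewrite fE lE l0 f0' polyC0 coprimep0 -polyC0 polyC_eqp1 eqxx.
  move=> t; rewrite !hornerE => nz.
  rewrite fE lE -mul_polyC -polyCM -polyCD unlock derivC coprimep0.
  by rewrite mulrC polyC_eqp1.
have [s Ws] := closed_field_poly_normal W.
pose Z := \prod_(z <- s) (f.[z]%:P + l.[z] *: 'X).
have Zt t : Z.[t] = \prod_(z <- s) (f + t *: l).[z].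
  by rewrite /Z horner_prod; apply: eq_bigr => z _; rewrite !hornerE [t * _]mulrC.
exists Z.
  apply/negP; rewrite prodf_seq_eq0 => /hasP[z zs /= /eqP/polyP e].
  have := e 0%N; have := e 1%N.
  rewrite !coefD !coefZ !coefX !coefC /= add0r mulr1 mulr0 addr0 => lz fz.
  have : root (gcdp f l) z by rewrite root_gcd /root fz lz !eqxx.
  by move: cop; rewrite -gcdp_eqp1 => /eqp_root ->; apply/negP/root1.
move=> t; rewrite Zt => nz; rewrite unlock.
have g0 : f + t *: l != 0.
  apply: contraNneq W0 => e.
  have fE : f = - t *: l by apply/eqP; rewrite scaleNr -addr_eq0 e.
  by rewrite /W fE derivZ -!scalerAl [l^`() * l]mulrC subrr.
apply: coprimepP_root => // z gz; apply/negP => g'z.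
have Wz : root W z.
  have -> : W = (f + t *: l)^`() * l - (f + t *: l) * l^`().
    by rewrite /W derivD derivZ -!mul_polyC; ring.
  by rewrite /root hornerD hornerN !hornerM (eqP gz) (eqP g'z) !mul0r subrr.
have zs : z \in s.
  by move: Wz; rewrite Ws rootZ ?lead_coef_eq0 // root_prod_XsubC.
by move: nz; rewrite (big_rem z) //= (eqP gz) mul0r eqxx.
Qed.

Lemma shift_coprime f l : f != 0 ->
  exists2 Z : {poly K}, Z != 0 & forall t, Z.[t] != 0 -> coprimep f (l + t%:P).
Proof.
move=> f0; have [s fs] := closed_field_poly_normal f.
exists (\prod_(z <- s) ('X - (- l.[z])%:P)).
  by rewrite monic_neq0 // monic_prod_XsubC.
move=> t nz; apply: coprimepP_root => // z.
rewrite {1}fs rootZ ?lead_coef_eq0 // root_prod_XsubC => zs.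
apply: contra nz => /eqP lz; rewrite (big_rem z) //= hornerM.
by move: lz; rewrite !hornerE opprK addrC => ->; rewrite mul0r.
Qed.

Section Critical.
Variables (f : {poly K}) (d : nat).
Hypotheses (d0 : (0 < d)%N) (sf : size f = d.*2.+1).

Definition critpoly l := jac (dlog_num f) (sqfree f) l.

(** The degree of the critical polynomial of a general [l], that is
    [d - 2 + r] for [r] the number of roots of [f]; recall that
    [size (sqfree f) = r + 1]. *)
Definition ncrit := (d + size (sqfree f) - 3)%N.

Let f0 : f != 0. Proof. by rewrite -size_poly_eq0 sf. Qed.

Let h := gcdp f f^`().

Let h0 : h != 0. Proof. by rewrite gcdp_eq0 negb_and f0. Qed.

Let w0 : sqfree f != 0.
Proof. by apply: contraNneq f0 => w0; rewrite [f]sqfreeM w0 mul0r. Qed.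

Let size_sqfree_gcd : (size (sqfree f) + size h = d.*2.+2)%N.
Proof.
have e : (size (sqfree f) + size h).-1 = d.*2.+1.
  by rewrite -sf {2}[f]sqfreeM size_mul.
have p : (0 < size h)%N by rewrite lt0n size_poly_eq0.
by lia.
Qed.

Lemma size_sqfree_gcdp :
  (size (sqfree f) + size (gcdp f f^`()) = d.*2.+2)%N.
Proof. exact: size_sqfree_gcd. Qed.

Lemma size_sqfree_gt1 : (1 < size (sqfree f))%N.
Proof.
have sh : (size h <= d.*2)%N.
  have f'0 : f^`() != 0 by rewrite -size_poly_eq0 size_num_deriv sf /= double_eq0 -lt0n.
  by have := dvdp_leq f'0 (dvdp_gcdr f f^`()); rewrite size_num_deriv sf.
by have := size_sqfree_gcd; lia.
Qed.

Lemma size_critpoly l : (size l <= d.+1)%N -> (size (critpoly l) <= ncrit.+1)%N.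
Proof.
move=> sl; have [->|c0] := eqVneq (critpoly l) 0; first by rewrite size_poly0.
have sJ : (size (critpoly l) + size h <= (d * 3).-1.+1)%N.
  rewrite -add1n -leq_subLR subn1 -size_mul // -jac_deriv.
  by apply: size_jac_deriv; rewrite ?sf.
by have := size_sqfree_gcd; have := size_sqfree_gt1; rewrite /ncrit; lia.
Qed.

Lemma size_critpoly_eq l : (size l <= d.+1)%N -> jaclead f d l != 0 ->
  size (critpoly l) = ncrit.+1.
Proof.
move=> sl nz.
suff h1 : (ncrit.+1 <= size (critpoly l))%N by apply/eqP; rewrite eqn_leq size_critpoly.
have J0 : (d * 3 <= (size (critpoly l) + size h).-1.+1)%N.
  rewrite leqNgt; apply/negP => lt; move/eqP: nz; apply.
  rewrite -coef_jac_lead ?sf // jac_deriv nth_default //.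
  by apply: leq_trans (size_polyMleq _ _) _; rewrite -ltnS -ltnS; apply: leq_trans lt _; lia.
by have := size_sqfree_gcd; have := size_sqfree_gt1; rewrite /ncrit; lia.
Qed.

(** At a common root of [f] and the critical polynomial [sqfree f] vanishes,
    and therefore so does [l], because [dlog_num f] does not.  At a common root
    of [l] and the critical polynomial either [l^`()] or [sqfree f] vanishes. *)
Lemma critpoly_coprime l : coprimep l l^`() -> coprimep f l ->
  coprimep (critpoly l) (l * f).
Proof.
move=> sepl cofl.
have notboth (a b : {poly K}) s : coprimep a b -> root a s -> root b s -> False.
  by move=> /coprimep_root h1 /h1; move=> /negPf h2 h3; rewrite /root h2 in h3.
have fl s : root f s -> root (critpoly l) s -> False.
  move=> fs; have ws : root (sqfree f) s by rewrite root_sqfree.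
  rewrite /root /critpoly /jac hornerD hornerN hornerMn !hornerM (eqP ws) mulr0 mul0rn subr0.
  rewrite mulf_eq0 => /orP[ls|ps]; first exact: (notboth f l s).
  exact: (notboth (sqfree f) (dlog_num f) s (coprime_sqfree_dlog_num f0) ws ps).
rewrite coprimep_sym; apply: coprimepP_root.
  rewrite mulf_neq0 //; apply: contraTneq cofl => ->.
  by rewrite coprimep0 -size_poly_eq1 sf eqSS double_eq0 -lt0n.
move=> s; rewrite rootM => /orP[ls|fs]; last by apply/negP/fl.
apply/negP => cs; have := cs; rewrite /root /critpoly /jac hornerD hornerN hornerMn !hornerM.
rewrite (eqP ls) mul0r sub0r oppr_eq0 mulrn_eq0 mulf_eq0 /= => /orP[l's|ws].
  exact: (notboth l l^`() s).
by apply: (fl s) => //; rewrite -root_sqfree.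
Qed.

(** In the pencil [('X - b)^d + t] the critical polynomial is
    [critpoly (('X - b)^d) + t *: dlog_num f].  Its two generators are coprime if
    [dlog_num f] does not vanish at [b], and then [pencil_separable] applies. *)
Lemma generic_witness : exists2 l : {poly K},
  (size l <= d.+1)%N & jaclead f d l != 0 /\
  coprimep (critpoly l) (l * f * (critpoly l)^`()).
Proof.
pose p := dlog_num f.
have p0 : p != 0.
  apply/negP => /eqP p0; have : f^`() == 0 by rewrite dlog_numM -/p p0 mul0r.
  by rewrite -size_poly_eq0 size_num_deriv sf /= double_eq0 -[_ == _]negbK -lt0n d0.
have lc0 : f`_d.*2 != 0 by have := f0; rewrite -lead_coef_eq0 lead_coefE sf.
pose a b : {poly K} := ('X - b%:P) ^+ d.
have sa b : size (a b) = d.+1 by rewrite /a size_exp_XsubC.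
have ad b : (a b)`_d = 1.
  by have := lead_coef_exp ('X - b%:P) d; rewrite lead_coefXsubC expr1n lead_coefE sa.
have ad1 b : (a b)`_d.-1 = - (b *+ d).
  have -> : a b = \prod_(z <- nseq d b) ('X - z%:P) by rewrite big_nseq iter_mulr_1.
  have e := @coefPn_prod_XsubC K (nseq d b).
  by move: e; rewrite size_nseq -lt0n => -> //; rewrite big_nseq iter_addr_0.
(* up to sign, the value at b of lead1 is the jaclead of ('X - b)^d *)
pose lead1 : {poly K} := (f`_d.*2 *+ d *+ 2) *: 'X + (f`_d.*2.-1)%:P.
have lead10 : lead1 != 0.
  apply/negP => /eqP/polyP/(_ 1%N)/eqP.
  rewrite coefD coefZ coefX coefC coef0 mulr1 addr0 !mulrn_eq0 /= (negbTE lc0).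
  by rewrite -[_ == _]negbK -lt0n d0.
have [b] := infinite_nonroot (mulf_neq0 p0 lead10).
rewrite hornerM mulf_eq0 negb_or => /andP[pb leadb].
pose l t := a b + t *: 1.
have sl t : (size (l t) <= d.+1)%N.
  apply: leq_trans (size_polyD _ _) _; rewrite geq_max sa leqnn /=.
  by apply: leq_trans (size_scale_leq _ _) _; rewrite size_polyC oner_eq0.
have jl t : jaclead f d (l t) = jaclead f d (a b) + t * jaclead f d 1.
  by rewrite /jaclead /l !coefD !coefZ; ring.
have cl t : critpoly (l t) = critpoly (a b) + t *: p.
  rewrite /critpoly /jac /l derivD derivZ derivC scaler0 addr0 -mul_polyC.
  by rewrite -mul_polyC -/p; ring.
have lab : jaclead f d (a b) != 0.
  move: leadb; rewrite !hornerE /jaclead ad ad1; apply: contra => /eqP e.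
  move: e; rewrite mul1r mulNr mulNrn !mulrnAl -opprD => /eqP.
  by rewrite oppr_eq0 [f`_ _ * b]mulrC.
(* at a root s of p, critpoly (a b) is - 2 d (s - b)^(d-1) sqfree f *)
have cop : coprimep (critpoly (a b)) p.
  rewrite coprimep_sym; apply: coprimepP_root => // s ps; apply/negP.
  have sb : s - b != 0 by rewrite subr_eq0; apply: contraNneq pb => <-.
  rewrite /root /critpoly /jac hornerD hornerN hornerMn !hornerM (eqP ps) mulr0 sub0r.
  rewrite oppr_eq0 mulrn_eq0 mulf_eq0 /a deriv_exp derivXsubC mul1r hornerMn mulrn_eq0.
  rewrite horner_exp hornerXsubC expf_eq0 (negbTE sb) andbF orbF /=.
  rewrite -[_ == 0%N]negbK -lt0n d0 /= => ws.
  by have := coprimep_root (coprime_sqfree_dlog_num f0) ws; rewrite (eqP ps) eqxx.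
have [Z2 Z20 h2] := pencil_separable cop.
have [Z3 Z30 h3] := pencil_separable (coprimep1 (a b)).
have [Z4 Z40 h4] := shift_coprime (a b) f0.
(* Z1, ..., Z4 vanish at the parameters t to be avoided *)
pose Z1 : {poly K} := (jaclead f d (a b))%:P + jaclead f d 1 *: 'X.
have Z10 : Z1 != 0.
  apply: contraNneq lab => /(congr1 (horner^~ 0)).
  by rewrite hornerD hornerC hornerZ hornerX mulr0 addr0 horner0 => ->.
have [t] := infinite_nonroot (mulf_neq0 (mulf_neq0 Z10 Z20) (mulf_neq0 Z30 Z40)).
rewrite !hornerM !mulf_eq0 !negb_or => /andP[/andP[n1 n2] /andP[n3 n4]].
exists (l t) => //; split.
  by move: n1; rewrite jl !hornerE mulrC.
rewrite coprimepMr critpoly_coprime.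
- by have := h2 _ n2; rewrite -cl unlock.
- by have := h3 _ n3; rewrite unlock.
- by have := h4 _ n4; rewrite /l alg_polyC.
Qed.

End Critical.
End Complex.

(** * The cone over the rational normal curve *)

Section Tangent.
Variables (K : fieldType) (n : nat).
Implicit Types (X : set 'rV[K]_n) (x v w : 'rV[K]_n) (f g : {mpoly K[n]}).

Definition dirder f x v : K := \sum_(i < n) (f^`M(i)).@[x 0] * v 0 i.

Lemma dirderB f g x v : dirder (f - g) x v = dirder f x v - dirder g x v.
Proof.
rewrite /dirder -sumrB; apply: eq_bigr => i _.
by rewrite mderivB mevalB mulrBl.
Qed.

Lemma dirderM f g x v :
  dirder (f * g) x v = dirder f x v * g.@[x 0] + f.@[x 0] * dirder g x v.
Proof.
rewrite /dirder mulr_suml mulr_sumr -big_split; apply: eq_bigr => i _ /=.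
by rewrite mderivM mevalD !mevalM; ring.
Qed.

Lemma dirderX i x v : dirder 'X_i x v = v 0 i.
Proof.
rewrite /dirder (bigD1 i) //= mderivX mnm1E eqxx scale1r big1 => [|j ne].
  have -> : (U_(i) - U_(i))%MM = 0%MM :> 'X_{1..n}.
    by apply/mnmP => j; rewrite mnmBE subnn mnm0E.
  by rewrite mpolyX0 meval1 mul1r addr0.
by rewrite mderivX mnm1E eq_sym (negbTE ne) scale0r meval0 mul0r.
Qed.

Lemma tangentD X x v w a b :
  tangent_space X x v -> tangent_space X x w ->
  tangent_space X x (a *: v + b *: w).
Proof.
move=> tv tw f Xf; have := tv f Xf; have := tw f Xf => e1 e2.
transitivity (a * \sum_(i < n) (f^`M(i)).@[x 0] * v 0 i +
              b * \sum_(i < n) (f^`M(i)).@[x 0] * w 0 i).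
  rewrite !mulr_sumr -big_split; apply: eq_bigr => i _ /=.
  by rewrite !mxE; ring.
by rewrite e1 e2 !mulr0 addr0.
Qed.

Lemma tangentZ X x v a : tangent_space X x v -> tangent_space X x (a *: v).
Proof. by move=> tv; have := tangentD a 0 tv tv; rewrite scale0r addr0. Qed.

End Tangent.

(** The equations of [X] vanish along the curve; differentiate. *)
Lemma tangent_curve (K : numFieldType) n (X : set 'rV[K]_n)
    (g : 'I_n -> {poly K}) t :
  (forall s, X (\row_i (g i).[s])) ->
  tangent_space X (\row_i (g i).[t]) (\row_i ((g i)^`()).[t]).
Proof.
move=> Xg f Xf.
have f0 : along g f = 0.
  apply: poly_vanish => s; rewrite alongE -(Xf _ (Xg s)).
  by apply: meval_eq => i; rewrite mxE.
have := deriv_along g f; rewrite f0 deriv0 => /(congr1 (horner^~ t)).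
rewrite horner0 horner_sum => e; apply/esym; rewrite [LHS]e.
apply: eq_bigr => i _; rewrite hornerM alongE mxE; congr (_ * _).
by apply: meval_eq => j; rewrite mxE.
Qed.

Section RNC.
Variables (K : numClosedFieldType) (d : nat).
Hypothesis d0 : (0 < d)%N.

Local Notation X := (@rational_normal_cone K d).
Local Notation v := (@veronese K d 1).
Local Notation oo := (delta_mx 0 ord_max : 'rV[K]_d.+1).

Definition dveronese s : 'rV[K]_d.+1 := \row_i ((i : nat)%:R * s ^+ i.-1).
Local Notation dv := dveronese.

Definition ord_one : 'I_d.+1 := Ordinal (d0 : (1 < d.+1)%N).

Lemma veroneseE s i : v s 0 i = s ^+ i.
Proof. by rewrite mxE expr1n mul1r. Qed.

Lemma veronese_infty b : veronese d 0 b = b ^+ d *: oo.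
Proof.
apply/rowP => i; rewrite !mxE eqxx /= expr0n subn_eq0.
have := ltn_ord i; rewrite ltnS leq_eqVlt => /orP[/eqP e|lt].
  by rewrite e leqnn mul1r (_ : i == ord_max) ?mulr1 // -val_eqE /= e.
rewrite leqNgt lt mul0r (_ : i == ord_max = false) ?mulr0 //.
by rewrite -val_eqE /= ltn_eqF.
Qed.

Lemma veronese_scale a s : veronese d a (a * s) = a ^+ d *: v s.
Proof.
apply/rowP => i; rewrite !mxE expr1n mul1r exprMn mulrA -exprD subnK //.
by rewrite -ltnS.
Qed.

(** The chart [a != 0] of the parameter line, and the direction of its point at
    infinity. *)
Variant rnc_spec (x : 'rV[K]_d.+1) : Prop :=
  | RncAffine c s of x = c *: v s
  | RncInfty c of x = c *: oo.

Lemma rncP x : X x <-> rnc_spec x.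
Proof.
split=> [[c [a [b [ab ->]]]]|[c s ->|c ->]].
- have [a0|a0] := eqVneq a 0.
    by apply: (@RncInfty _ (c * b ^+ d)); rewrite a0 veronese_infty scalerA.
  apply: (@RncAffine _ (c * a ^+ d) (a^-1 * b)).
  by rewrite -scalerA -veronese_scale mulrA divff // mul1r.
- exists c, 1, s; split=> //; apply/negP => /eqP[/eqP].
  by rewrite oner_eq0.
- exists c, 0, 1; rewrite veronese_infty expr1n scale1r; split=> //.
  by apply/negP => /eqP[/eqP]; rewrite oner_eq0.
Qed.

Lemma rnc_veronese a b : X (veronese d a b).
Proof.
apply/rncP; have [->|a0] := eqVneq a 0.
  by rewrite veronese_infty; apply: RncInfty.
apply: (@RncAffine _ (a ^+ d) (a^-1 * b)).
by rewrite -veronese_scale mulrA divff // mul1r.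
Qed.

(** The scalar factor is absorbed by a [d]-th root. *)
Lemma rnc_param x : X x -> exists a b, x = veronese d a b.
Proof.
case/rncP => [c s ->|c ->].
  by exists (d.-root c), (d.-root c * s); rewrite veronese_scale rootCK.
by exists 0, (d.-root c); rewrite veronese_infty rootCK.
Qed.

Lemma rncZ c x : X x -> X (c *: x).
Proof.
case/rncP => [a s ->|a ->]; apply/rncP; rewrite scalerA.
  exact: RncAffine.
exact: RncInfty.
Qed.

Definition minor (i j : 'I_d) : {mpoly K[d.+1]} :=
  'X_(widen_ord (leqnSn d) i) * 'X_(lift ord0 j)
  - 'X_(lift ord0 i) * 'X_(widen_ord (leqnSn d) j).

Lemma minorE i j (x : 'I_d.+1 -> K) : (minor i j).@[x] =
  x (widen_ord (leqnSn d) i) * x (lift ord0 j)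
  - x (lift ord0 i) * x (widen_ord (leqnSn d) j).
Proof. by rewrite mevalB !mevalM !mevalXU. Qed.

Lemma minor_vanish i j : vanishing_ideal X (minor i j).
Proof.
move=> x /rnc_param[a [b ->]]; rewrite minorE !mxE /= /bump !add1n.
have e k : (k < d)%N -> a ^+ (d - k) = a * a ^+ (d - k.+1).
  by move=> h; rewrite -exprS subnSK.
rewrite (e i) ?(e j) ?ltn_ord // !exprS.
by move: (a ^+ _) (a ^+ _) (b ^+ _) (b ^+ _) => a1 a2 b1 b2; ring.
Qed.

(** If [x 0 0 != 0], the coordinates form a geometric progression.  Otherwise
    [x_(k+1)^2 = x_k x_(k+2)] kills all of them but the last one. *)
Lemma rnc_minors (x : 'rV[K]_d.+1) :
  (forall i j, (minor i j).@[x 0] = 0) -> X x.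
Proof.
move=> h; pose y k := x 0 (inord k).
have hy i j : (i < d)%N -> (j < d)%N -> y i * y j.+1 = y i.+1 * y j.
  move=> hi hj; have := h (Ordinal hi) (Ordinal hj); rewrite minorE.
  move/eqP; rewrite subr_eq0 => /eqP.
  have -> : widen_ord (leqnSn d) (Ordinal hi) = inord i.
    by apply: val_inj; rewrite /= inordK // ltnS ltnW.
  have -> : widen_ord (leqnSn d) (Ordinal hj) = inord j.
    by apply: val_inj; rewrite /= inordK // ltnS ltnW.
  have -> : lift ord0 (Ordinal hi) = inord i.+1.
    by apply: val_inj; rewrite /= inordK.
  have -> : lift ord0 (Ordinal hj) = inord j.+1 by apply: val_inj; rewrite /= inordK.
  by [].
have xy i : x 0 i = y i by rewrite /y inord_val.
apply/rncP; have [y0|y0] := eqVneq (y 0%N) 0.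
  have yk k : (k < d)%N -> y k = 0.
    elim: k => // k IH hk; have := hy k k.+1; rewrite IH ?(ltnW hk) // mul0r => e.
    by apply/eqP; have /eqP := esym (e isT hk); rewrite mulf_eq0 orbb.
  apply: (@RncInfty _ (y d)); apply/rowP => i; rewrite !mxE xy eqxx /=.
  have := ltn_ord i; rewrite ltnS leq_eqVlt => /orP[/eqP e|lt].
    by rewrite e (_ : i == ord_max) ?mulr1 // -val_eqE /= e.
  rewrite yk // (_ : i == ord_max = false) ?mulr0 //.
  by rewrite -val_eqE /= ltn_eqF.
apply: (@RncAffine _ (y 0%N) (y 1%N / y 0%N)).
have yk k : (k <= d)%N -> y k = y 0%N * (y 1%N / y 0%N) ^+ k.
  elim: k => [|k IH] hk; first by rewrite mulr1.
  apply: (mulfI y0); rewrite hy ?d0 // IH ?(ltnW hk) // exprS.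
  by field.
by apply/rowP => i; rewrite mxE veroneseE xy yk // -ltnS.
Qed.

(** * Tangent spaces of the cone *)

Lemma tangent_veronese c s : c != 0 -> tangent_space X (c *: v s) (v s).
Proof.
move=> c0; have h t : X (\row_i ((c * s ^+ i) *: 'X : {poly K}).[t]).
  rewrite (_ : \row_i _ = (t * c) *: v s); first by apply/rncZ/rnc_veronese.
  by apply/rowP => i; rewrite mxE hornerZ hornerX mxE veroneseE; ring.
have := tangentZ c^-1 (tangent_curve 1 h).
rewrite (_ : \row_i _ = c *: v s); last first.
  by apply/rowP => i; rewrite mxE hornerZ hornerX mxE veroneseE mulr1.
rewrite (_ : c^-1 *: _ = v s) //.
by apply/rowP => i; rewrite !mxE derivZ derivX hornerZ hornerC expr1n; field.
Qed.

Lemma tangent_dveronese c s : c != 0 -> tangent_space X (c *: v s) (dv s).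
Proof.
move=> c0; have h t : X (\row_i (c *: 'X^i : {poly K}).[t]).
  rewrite (_ : \row_i _ = c *: v t); first by apply/rncZ/rnc_veronese.
  by apply/rowP => i; rewrite mxE hornerZ hornerXn mxE veroneseE.
have := tangentZ c^-1 (tangent_curve s h).
rewrite (_ : \row_i _ = c *: v s); last first.
  by apply/rowP => i; rewrite mxE hornerZ hornerXn mxE veroneseE.
rewrite (_ : c^-1 *: _ = dv s) //; apply/rowP => i.
by rewrite !mxE derivZ derivXn hornerZ hornerMn hornerXn mulrA mulVf // mul1r mulr_natl.
Qed.

(** The cone contains the line through the vertex and [v s]. *)
Lemma tangent0 s : tangent_space X 0 (v s).
Proof.
have h t : X (\row_i ((s ^+ i) *: 'X : {poly K}).[t]).
  rewrite (_ : \row_i _ = t *: v s); first by apply/rncZ/rnc_veronese.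
  by apply/rowP => i; rewrite mxE hornerZ hornerX mxE veroneseE; ring.
have := tangent_curve 0 h.
rewrite (_ : \row_i _ = 0); last first.
  by apply/rowP => i; rewrite !mxE hornerZ hornerX mulr0.
rewrite (_ : \row_i _ = v s) //; apply/rowP => i.
by rewrite !mxE derivZ derivX hornerZ hornerC expr1n; ring.
Qed.

Lemma tangent_infty c : c != 0 ->
  tangent_space X (c *: oo) oo /\
  tangent_space X (c *: oo) (delta_mx 0 (inord d.-1)).
Proof.
move=> c0; split.
  have h t : X (\row_i (((c *: oo) 0 i) *: 'X : {poly K}).[t]).
    apply/rncP; apply: (@RncInfty _ (t * c)).
    by apply/rowP => i; rewrite mxE hornerZ hornerX !mxE; ring.
  have := tangentZ c^-1 (tangent_curve 1 h).
  rewrite (_ : \row_i _ = c *: oo); last first.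
    by apply/rowP => i; rewrite mxE hornerZ hornerX mulr1.
  rewrite (_ : c^-1 *: _ = oo) //; apply/rowP => i.
  by rewrite !mxE derivZ derivX hornerZ hornerC; field.
have h t : X (\row_i (c *: 'X^(d - i) : {poly K}).[t]).
  rewrite (_ : \row_i _ = c *: veronese d t 1); first by apply/rncZ/rnc_veronese.
  by apply/rowP => i; rewrite mxE hornerZ hornerXn !mxE expr1n mulr1.
have := tangentZ c^-1 (tangent_curve 0 h).
rewrite (_ : \row_i _ = c *: oo); last first.
  rewrite -[oo]scale1r -(expr1n _ d) -veronese_infty.
  by apply/rowP => i; rewrite mxE hornerZ hornerXn !mxE expr1n mulr1.
rewrite (_ : c^-1 *: _ = delta_mx 0 (inord d.-1)) //; apply/rowP => i.
rewrite !mxE derivZ derivXn hornerZ hornerMn hornerXn mulrA mulVf // mul1r eqxx /=.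
rewrite expr0n -val_eqE /= inordK; last by rewrite ltnS leq_pred.
have := ltn_ord i; rewrite ltnS leq_eqVlt => /orP[/eqP e|lt].
  by rewrite e subnn mulr0n (_ : d == d.-1 = false) //; lia.
case: (ltnP i d.-1) => hi.
  have -> : ((d - i).-1 == 0)%N = false by lia.
  by rewrite mul0rn (ltn_eqF hi).
have -> : (i == d.-1 :> nat) by lia.
by have -> : (d - i = 1)%N by lia.
Qed.

(** The minors [x_0 x_(k+1) - x_1 x_k], differentiated at [c *: v s], express
    every coordinate of a tangent vector by the first two. *)
Lemma tangent_rnc_span c s w : c != 0 -> tangent_space X (c *: v s) w ->
  w = w 0 ord0 *: v s + (w 0 ord_one - s * w 0 ord0) *: dv s.
Proof.
move=> c0 tw.
have step (k : 'I_d) : w 0 (lift ord0 k) =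
    s * w 0 (widen_ord (leqnSn d) k) + s ^+ k * (w 0 ord_one - s * w 0 ord0).
  have := tw _ (minor_vanish (Ordinal d0) k).
  rewrite -/(dirder _ _ _) dirderB !dirderM !dirderX !mevalXU.
  have -> : widen_ord (leqnSn d) (Ordinal d0) = ord0 by apply: val_inj.
  have -> : lift ord0 (Ordinal d0) = ord_one by apply: val_inj.
  rewrite !mxE /= /bump !add1n !expr1n !mul1r !expr0 !expr1 !mulr1 exprS.
  move=> e; apply: (mulfI c0); apply/eqP; rewrite -subr_eq0 -[X in _ == X]e.
  by apply/eqP; ring.
have main k (hk : (k < d.+1)%N) : w 0 (Ordinal hk) =
    s ^+ k * w 0 ord0 + k%:R * s ^+ k.-1 * (w 0 ord_one - s * w 0 ord0).
  elim: k hk => [|k IH] hk.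
    by rewrite expr0 mul1r !mul0r addr0; congr (w 0 _); apply: val_inj.
  have := step (Ordinal (hk : (k < d)%N)).
  have -> : lift ord0 (Ordinal (hk : (k < d)%N)) = Ordinal hk by apply: val_inj.
  have -> : widen_ord (leqnSn d) (Ordinal (hk : (k < d)%N)) = Ordinal (ltnW hk).
    by apply: val_inj.
  move=> ->; rewrite IH /= -[in RHS]natr1 exprS.
  by case: k {IH hk} => [|k] /=; rewrite ?exprS; ring.
apply/rowP => i; rewrite !mxE expr1n mul1r.
have := main _ (ltn_ord i); rewrite (_ : Ordinal (ltn_ord i) = i); last exact: val_inj.
by move=> ->; ring.
Qed.

End RNC.

(** * Dimension and smoothness *)

Lemma meval_mmapC (K : comNzRingType) n m (F : 'I_n -> {mpoly K[m]})
    (f : {mpoly K[n]}) (u : 'I_m -> K) :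
  (mmap (@mpolyC m K) F f).@[u] = f.@[fun i => (F i).@[u]].
Proof.
rewrite [RHS]mevalE /mmap raddf_sum; apply: eq_bigr => k _ /=.
rewrite mevalM mevalC; congr (_ * _); rewrite /mmap1 rmorph_prod /=.
by apply: eq_bigr => i _; rewrite rmorphXn.
Qed.

Section Dependence.
Variable K : fieldType.

Let deg m (p : {mpoly K[m]}) := (msize p).-1.

Let degM m (p q : {mpoly K[m]}) : (deg (p * q) <= deg p + deg q)%N.
Proof.
rewrite /deg; have [->|p0] := eqVneq p 0; first by rewrite mul0r !msize0.
have [->|q0] := eqVneq q 0; first by rewrite mulr0 !msize0.
have : (0 < msize p)%N by rewrite lt0n msize_poly_eq0.
have : (0 < msize q)%N by rewrite lt0n msize_poly_eq0.
rewrite msizeM //.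
by move: (msize p) (msize q) => a b; lia.
Qed.

Let degX m (p : {mpoly K[m]}) k : (deg (p ^+ k) <= k * deg p)%N.
Proof.
elim: k => [|k IH]; first by rewrite expr0 /deg msize1.
by rewrite exprS mulSn; apply: leq_trans (degM _ _) _; rewrite leq_add2l.
Qed.

(** Counting: there are [(k + 1)^3] monomials in the [F i] with exponents at most
    [k], and they lie in a space of dimension [m^2], where [m] grows linearly
    with [k]. *)
Lemma three_dependent (F : 'I_3 -> {mpoly K[2]}) :
  exists2 g : {mpoly K[3]}, g != 0 & mmap (@mpolyC 2 K) F g = 0.
Proof.
pose D := (\sum_(i < 3) deg (F i))%N.
(* m <= (3 D + 1) (k + 1), so that m^2 <= k (k + 1)^2 < (k + 1)^3 *)
pose k := ((3 * D).+1 ^ 2)%N.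
pose m := (k * (3 * D)).+1.
pose I := {ffun 'I_3 -> 'I_k.+1}; pose J := ('I_m * 'I_m)%type.
pose mI (h : I) : 'X_{1..3} := [multinom (h i : nat) | i < 3].
pose mJ (h : J) : 'X_{1..2} := [multinom (if val i == 0%N then (h.1 : nat) else h.2) | i < 2].
pose G (h : I) : {mpoly K[2]} := \prod_(i < 3) F i ^+ h i.
have leD i : (deg (F i) <= D)%N by rewrite /D (bigD1 i) //= leq_addr.
have degG h : (deg (G h) < m)%N.
  rewrite /G ltnS !big_ord_recl big_ord0 mulr1.
  have b i : (deg (F i ^+ h i) <= k * D)%N.
    by apply: leq_trans (degX _ _) _; rewrite leq_mul // -ltnS.
  apply: leq_trans (degM _ _) _; rewrite (_ : 3 * D = D + (D + D))%N; last by lia.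
  rewrite !mulnDr leq_add //; apply: leq_trans (degM _ _) _.
  by rewrite leq_add.
pose C : 'M[K]_(#|{: I}|, #|{: J}|) := \matrix_(a, b) (G (enum_val a))@_(mJ (enum_val b)).
have [c c0 cC] : exists2 c : 'rV[K]_#|{: I}|, c != 0 & c *m C = 0.
  have : kermx C != 0.
    rewrite -mxrank_eq0 mxrank_ker subn_eq0 -ltnNge.
    apply: leq_ltn_trans (rank_leq_col _) _.
    rewrite card_ffun card_prod !card_ord.
    have : (m <= (3 * D).+1 * k.+1)%N by rewrite /m; nia.
    move=> h; apply: leq_ltn_trans (leq_mul h h) _.
    rewrite -[(_ * _ * _)%N]/(((3 * D).+1 * k.+1) ^ 2)%N expnMn -/k expnS.
    by rewrite ltn_mul2r muln_gt0 expn_gt0 ltnS leqnn.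
  by case/rowV0Pn => c /sub_kermxP cC c0; exists c.
pose g : {mpoly K[3]} := \sum_a c 0 a *: 'X_[mI (enum_val a)].
have mIinj : injective mI.
  move=> h1 h2 /mnmP e; apply/ffunP => i; apply: val_inj.
  by have := e i; rewrite !mnmE.
exists g.
  apply: contraNneq c0 => g0; apply/eqP/rowP => a; rewrite mxE.
  have := congr1 (mcoeff (mI (enum_val a))) g0; rewrite mcoeff0 => <-.
  rewrite /g raddf_sum /= (bigD1 a) //= mcoeffZ mcoeffX eqxx mulr1 big1 ?addr0 //.
  move=> b ne; rewrite mcoeffZ mcoeffX (inj_eq mIinj) (inj_eq enum_val_inj).
  by rewrite (negbTE ne) mulr0.
have gE : mmap (@mpolyC 2 K) F g = \sum_a c 0 a *: G (enum_val a).
  rewrite /g raddf_sum; apply: eq_bigr => a _ /=; rewrite mmapZ mmapX mul_mpolyC.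
  by congr (_ *: _); apply: eq_bigr => i _; rewrite mnmE.
rewrite gE; apply/mpolyP => mm; rewrite mcoeff0 raddf_sum /=.
have [lt|ge] := ltnP (mdeg mm) m; last first.
  apply: big1 => a _; rewrite mcoeffZ memN_msupp_eq0 ?mulr0 //.
  apply: msize_mdeg_ge; apply: leq_trans ge.
  by have := degG (enum_val a); rewrite /deg; case: (msize _).
have l0 : (mm ord0 < m)%N.
  by apply: leq_ltn_trans lt; rewrite mdegE big_ord_recl leq_addr.
have l1 : (mm ord_max < m)%N.
  apply: leq_ltn_trans lt; rewrite mdegE !big_ord_recl big_ord0 addn0.
  by rewrite (_ : lift _ _ = ord_max) ?leq_addl //; apply: val_inj.
pose j : J := (Ordinal l0, Ordinal l1).
have mjE : mm = mJ j.
  apply/mnmP => i; rewrite mnmE; case: i => -[|[|//]] hi /=.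
    by congr (mm _); apply: val_inj.
  by congr (mm _); apply: val_inj.
have := congr1 (fun M : 'rV_#|{: J}| => M 0 (enum_rank j)) cC.
rewrite !mxE => e; apply: etrans e; apply: eq_bigr => a _.
by rewrite mcoeffZ !mxE enum_rankK -mjE.
Qed.

End Dependence.

Section Smooth.
Variables (K : numClosedFieldType) (d : nat).
Hypothesis d0 : (0 < d)%N.

Local Notation X := (@rational_normal_cone K d).
Local Notation v := (@veronese K d 1).
Local Notation dv := (@dveronese K d).

(** The first two coordinates are independent, since [(c, c s)] runs through all
    pairs with nonzero first entry.  Three functions are dependent, since they
    pull back to polynomials in the two parameters. *)
Lemma rnc_dim : has_dimension X 2.
Proof.
have d1 : (2 <= d.+1)%N by [].
split.
  exists (fun i => 'X_(widen_ord d1 i)) => g gX.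
  suff : 'X_ord0 * g = 0.
    move/eqP; rewrite mulf_eq0 => /orP[|/eqP//].
    by rewrite -msize_poly_eq0 msizeX.
  apply: mpoly_vanish => u; rewrite mevalM mevalXU.
  have [->|u0] := eqVneq (u ord0) 0; first by rewrite mul0r.
  have h : X (u ord0 *: v (u ord_max / u ord0)) by apply/rncZ/rnc_veronese.
  suff -> : g.@[u] = 0 by rewrite mulr0.
  apply: etrans (gX _ h); apply: meval_eq => i.
  rewrite mevalXU mxE veroneseE; case: i => -[|[|//]] hi /=.
    by rewrite expr0 mulr1; congr (u _); apply: val_inj.
  by rewrite expr1 mulrC divfK //; congr (u _); apply: val_inj.
case=> f fX.
pose mon (i : 'I_d.+1) : {mpoly K[2]} := 'X_ord0 ^+ (d - i) * 'X_ord_max ^+ i.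
have [g g0 gF] := three_dependent (fun i => mmap (@mpolyC 2 K) mon (f i)).
case/eqP: g0; apply: fX => x /(rnc_param d0)[a [b ->]].
have := congr1 (meval (fun i : 'I_2 => if val i == 0%N then a else b)) gF.
rewrite meval_mmapC meval0 => e; apply: etrans e; apply: meval_eq => i.
rewrite meval_mmapC; apply: meval_eq => j.
by rewrite mevalM !rmorphXn /= !mevalXU mxE.
Qed.

Lemma rnc_smooth c s : c != 0 -> smooth_locus X (c *: v s).
Proof.
move=> c0; split; first exact/rncZ/rnc_veronese.
have v00 : v s 0 ord0 = 1 by rewrite veroneseE expr0.
have dv00 : dv s 0 ord0 = 0 by rewrite mxE mul0r.
have dv01 : dv s 0 (ord_one d0) = 1 by rewrite mxE mul1r expr0.
pose T : {vspace 'rV[K]_d.+1} := <<[:: v s; dv s]>>%VS.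
have fr : free [:: v s; dv s].
  rewrite free_cons seq1_free span_seq1; apply/andP; split.
    apply/vlineP => -[k e]; have := congr1 (fun w : 'rV_d.+1 => w 0 ord0) e.
    by rewrite v00 mxE dv00 mulr0 => /eqP; rewrite oner_eq0.
  apply/eqP => e; have := congr1 (fun w : 'rV_d.+1 => w 0 (ord_one d0)) e.
  by rewrite dv01 mxE => /eqP; rewrite oner_eq0.
exists T.
  by move: fr => /eqP; rewrite -/T /= => ->; apply: rnc_dim.
move=> w; split.
  rewrite /T span_cons span_seq1 => /memv_addP[_ /vlineP[a ->] [_ /vlineP[b ->] ->]].
  apply: tangentD; [exact: tangent_veronese|exact: tangent_dveronese].
move=> tw; rewrite (tangent_rnc_span d0 c0 tw).
by apply: memvD; apply: memvZ; apply: memv_span; rewrite !inE eqxx ?orbT.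
Qed.

End Smooth.

(** * Bilinear forms on the curve *)

Section Form.
Variables (K : fieldType) (n : nat) (M : 'M[K]_n).
Local Notation Q := (form_of_matrix idfun M).

Lemma mxformE (u w : 'rV[K]_n) : Q u w = \sum_i (u *m M) 0 i * w 0 i.
Proof.
rewrite /form_of_matrix trace_mx11 mxE; apply: eq_bigr => i _.
by rewrite !mxE.
Qed.

Lemma mxformBl (u x w : 'rV[K]_n) : Q (u - x) w = Q u w - Q x w.
Proof. by rewrite !mxformE -sumrB; apply: eq_bigr => i _; rewrite mulmxBl !mxE mulrBl. Qed.

Lemma mxformZl c (x w : 'rV[K]_n) : Q (c *: x) w = c * Q x w.
Proof. by rewrite !mxformE mulr_sumr; apply: eq_bigr => i _; rewrite -scalemxAl !mxE mulrA. Qed.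

Lemma mxformDr (u x w : 'rV[K]_n) : Q u (x + w) = Q u x + Q u w.
Proof. by rewrite !mxformE -big_split; apply: eq_bigr => i _; rewrite !mxE mulrDr. Qed.

Lemma mxformZr c (x w : 'rV[K]_n) : Q x (c *: w) = c * Q x w.
Proof. by rewrite !mxformE mulr_sumr; apply: eq_bigr => i _; rewrite !mxE mulrCA. Qed.

Lemma mxform_sym (u w : 'rV[K]_n) : M^T = M -> Q u w = Q w u.
Proof.
move=> sM; rewrite /form_of_matrix -mxtrace_tr; congr (\tr _).
by rewrite !map_mx_id // !trmx_mul trmxK sM mulmxA.
Qed.

End Form.

Lemma card_uniq_seq (T : choiceType) (s : seq T) :
  uniq s -> [set` s] #= `I_(size s).
Proof.
case: (ltnP 0 (size s)) => [|]; last first.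
  rewrite leqn0 size_eq0 => /eqP -> _; rewrite II0 card_eq0.
  by apply/eqP/seteqP; split.
case Es: s => [//|x0 s'] _; rewrite -{}Es => us.
have -> : [set` s] = nth x0 s @` `I_(size s).
  apply/seteqP; split=> x /=.
    by move=> xs; exists (index x s); [rewrite /= index_mem|exact: nth_index].
  by case=> i /= hi <-; apply: mem_nth.
apply: inj_card_eq => i j; rewrite !inE /= => hi hj /eqP.
by rewrite nth_uniq // => /eqP.
Qed.

Section Restriction.
Variables (K : numClosedFieldType) (d : nat) (M : 'M[K]_d.+1).
Local Notation Q := (form_of_matrix idfun M).
Local Notation v := (@veronese K d 1).
Local Notation dv := (@dveronese K d).

Definition normpoly : {poly K} :=
  \sum_(i < d.+1) \sum_(j < d.+1) M i j *: ('X^i * 'X^j).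

Definition lpoly (u : 'rV[K]_d.+1) : {poly K} := rVpoly (u *m M).

Lemma size_lpoly u : (size (lpoly u) <= d.+1)%N.
Proof. exact: size_poly. Qed.

Lemma horner_rVpoly_veronese (y : 'rV[K]_d.+1) s :
  (rVpoly y).[s] = \sum_i y 0 i * v s 0 i.
Proof.
rewrite (horner_coef_wide _ (size_poly _ _)); apply: eq_bigr => i _.
by rewrite coef_rVpoly_ord veroneseE.
Qed.

Lemma horner_lpoly u s : (lpoly u).[s] = Q u (v s).
Proof. by rewrite horner_rVpoly_veronese mxformE. Qed.

Lemma deriv_lpoly u s : (lpoly u)^`().[s] = Q u (dv s).
Proof.
rewrite mxformE; have h : (size (lpoly u)^`() <= d.+1)%N.
  by apply: leq_trans (size_poly _ _) _; apply: leq_trans (leq_pred _) (size_lpoly u).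
rewrite (horner_coef_wide _ h) [RHS]big_ord_recl [dv s 0 ord0]mxE mul0r mulr0 add0r.
rewrite big_ord_recr /= coef_deriv (nth_default 0 (size_lpoly u)) mul0rn mul0r addr0.
apply: eq_bigr => i _; rewrite coef_deriv -(coef_rVpoly_ord (u *m M)) mxE /=.
by rewrite -/(lpoly u) /bump add1n add0n /= mulrA mulr_natr.
Qed.

Lemma horner_normpoly s : normpoly.[s] = Q (v s) (v s).
Proof.
rewrite /normpoly mxformE horner_sum.
transitivity (\sum_(i < d.+1) \sum_(j < d.+1) M i j * (s ^+ i * s ^+ j)).
  apply: eq_bigr => i _; rewrite horner_sum; apply: eq_bigr => j _.
  by rewrite hornerZ hornerM !hornerXn.
rewrite exchange_big; apply: eq_bigr => j _ /=.
rewrite mxE mulr_suml; apply: eq_bigr => i _.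
by rewrite !veroneseE mulrCA mulrA.
Qed.

Lemma deriv_normpoly s : M^T = M -> normpoly^`().[s] = Q (v s) (dv s) *+ 2.
Proof.
move=> sM; rewrite mulr2n {1}(mxform_sym _ _ sM) !mxformE /normpoly !raddf_sum horner_sum /=.
transitivity (\sum_(i < d.+1) \sum_(j < d.+1)
    (M i j * dv s 0 i * v s 0 j + M i j * v s 0 i * dv s 0 j)).
  apply: eq_bigr => i _; rewrite raddf_sum horner_sum /=; apply: eq_bigr => j _.
  rewrite derivZ hornerZ derivM !derivXn hornerD !hornerM !hornerMn !hornerXn.
  by rewrite !veroneseE !mxE !mulr_natl mulrDr !mulrA.
rewrite exchange_big -big_split /=; apply: eq_bigr => j _.
rewrite !mxE !mulr_suml -big_split; apply: eq_bigr => i _ /=.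
by rewrite [M i j * _]mulrC [M i j * v s 0 i]mulrC.
Qed.

Lemma coef_normpoly k : normpoly`_k =
  \sum_(i < d.+1) \sum_(j < d.+1) if (i + j == k)%N then M i j else 0.
Proof.
rewrite /normpoly coef_sum; apply: eq_bigr => i _; rewrite coef_sum.
apply: eq_bigr => j _; rewrite coefZ -exprD coefXn eq_sym.
by case: eqP; rewrite (mulr1, mulr0).
Qed.

Lemma coef_normpoly_lead : normpoly`_d.*2 = M ord_max ord_max.
Proof.
rewrite coef_normpoly (bigD1 ord_max) //= (bigD1 ord_max) //= addnn eqxx.
rewrite !big1 ?addr0 // => [i ne|j ne].
  apply: big1 => j _; case: eqP => // e; case/eqP: ne; apply: val_inj => /=.
  by have := ltn_ord i; have := ltn_ord j; lia.
by case: eqP => // e; case/eqP: ne; apply: val_inj => /=; lia.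
Qed.

Lemma size_normpoly_le : (size normpoly <= d.*2.+1)%N.
Proof.
apply/leq_sizeP => k hk; rewrite coef_normpoly big1 // => i _; apply: big1 => j _.
by case: eqP => // e; have := ltn_ord i; have := ltn_ord j; lia.
Qed.

Lemma size_normpoly : M ord_max ord_max != 0 -> size normpoly = d.*2.+1.
Proof.
move=> nz; apply/eqP; rewrite eqn_leq size_normpoly_le ltnNge; apply: contra nz.
by move=> h; rewrite -coef_normpoly_lead nth_default.
Qed.

Lemma coef_normpoly_sublead : (0 < d)%N -> M^T = M ->
  normpoly`_d.*2.-1 = M (inord d.-1) ord_max *+ 2.
Proof.
move=> d0 sM; have im : (inord d.-1 : 'I_d.+1) = d.-1 :> nat.
  by rewrite inordK // ltnS leq_pred.
rewrite coef_normpoly (bigD1 ord_max) //= [X in X + _](bigD1 (inord d.-1)) //=.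
rewrite [X in _ + _ + X](bigD1 (inord d.-1)) /=; last by rewrite -val_eqE /= im; lia.
rewrite [X in _ + _ + (X + _)](bigD1 ord_max) //= im.
rewrite (_ : (d + d.-1 == d.*2.-1)%N); last by lia.
rewrite (_ : (d.-1 + d == d.*2.-1)%N); last by lia.
rewrite !big1 ?addr0 => [|i /andP[]|j|j].
- by rewrite -[in LHS]sM mxE sM mulr2n.
- rewrite -!val_eqE /= im => h1 h2; apply: big1 => j _; case: eqP => // e.
  by have := ltn_ord i; have := ltn_ord j; lia.
- rewrite -!val_eqE /= => h1; case: eqP => // e.
  by have := ltn_ord j; lia.
- rewrite -!val_eqE /= im => h1; case: eqP => // e.
  by have := ltn_ord j; lia.
Qed.

End Restriction.

(** * The critical equations with indeterminate data *)

Section Generic.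
Variables (K : numClosedFieldType) (d : nat) (M : 'M[K]_d.+1) (m : nat).
Variable y : 'rV[{mpoly K[m]}]_d.+1.
Local Notation f := (normpoly M).
Local Notation C := (@mpolyC m K).

(** [glpoly], [gcrit] and [gjaclead] are [lpoly], [critpoly] and [jaclead] for a
    data vector [y] of polynomials; with variables as its entries, polynomial
    conditions on the data point become nonvanishing of one polynomial. *)
Definition glpoly : {poly {mpoly K[m]}} := rVpoly (y *m map_mx C M).

Definition gcrit : {poly {mpoly K[m]}} :=
  jac (map_poly C (dlog_num f)) (map_poly C (sqfree f)) glpoly.

Definition gjaclead : {mpoly K[m]} := jaclead (map_poly C f) d glpoly.

Variables (z : 'I_m -> K) (u : 'rV[K]_d.+1).
Hypothesis yu : map_mx (meval z) y = u.

Lemma map_meval_C (p : {poly K}) : map_poly (meval z) (map_poly C p) = p.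
Proof.
by rewrite -map_poly_comp map_poly_id // => c _ /=; rewrite mevalC.
Qed.

Lemma map_glpoly : map_poly (meval z) glpoly = lpoly M u.
Proof.
rewrite /glpoly map_rVpoly map_mxM yu; congr (rVpoly (_ *m _)).
by apply/matrixP => i j; rewrite !mxE /= mevalC.
Qed.

Lemma map_gcrit : map_poly (meval z) gcrit = critpoly f (lpoly M u).
Proof. by rewrite /gcrit map_jac !map_meval_C map_glpoly. Qed.

Lemma meval_gjaclead : gjaclead.@[z] = jaclead f d (lpoly M u).
Proof.
rewrite /gjaclead /jaclead -map_glpoly mevalB mevalMn !mevalM -!coef_map.
by rewrite !map_meval_C.
Qed.

Lemma meval_sylv a b (p q : {poly {mpoly K[m]}}) :
  (\det (sylv a b p q)).@[z] =
  \det (sylv a b (map_poly (meval z) p) (map_poly (meval z) q)).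
Proof. by rewrite -map_sylv det_map_mx. Qed.

End Generic.

(** * Linear vector fields tangent to the cone *)

Section Fields.
Variables (K : numClosedFieldType) (d : nat).
Hypothesis d0 : (0 < d)%N.
Local Notation X := (@rational_normal_cone K d).

(** With the identity, [lower] and [raise] represent the derivations
    [a d/db], [b d/da] and (up to a factor [d]) the Euler derivation of binary
    forms: they act on the coordinates of [veronese d a b] as linear maps. *)
Definition lower : 'M[K]_d.+1 := \matrix_(i, j) ((j : nat)%:R * (j == i.+1 :> nat)%:R).
Definition raise : 'M[K]_d.+1 := \matrix_(i, j) ((d - j)%:R * (i == j.+1 :> nat)%:R).

Lemma tangent_id x : X x -> tangent_space X x (x *m 1%:M).
Proof.
move=> Xx; have h t : X (\row_i ((x 0 i) *: 'X : {poly K}).[t]).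
  rewrite (_ : \row_i _ = t *: x); first exact: rncZ.
  by apply/rowP => i; rewrite !mxE hornerZ hornerX mulrC.
have := tangent_curve 1 h.
rewrite (_ : \row_i _ = x); last first.
  by apply/rowP => i; rewrite mxE hornerZ hornerX mulr1.
rewrite (_ : \row_i _ = x *m 1%:M) // mulmx1; apply/rowP => i.
by rewrite mxE derivZ derivX hornerZ hornerC mulr1.
Qed.

Lemma mul_lower (x : 'rV[K]_d.+1) j :
  (x *m lower) 0 j = (j : nat)%:R * x 0 (inord j.-1).
Proof.
rewrite mxE; case: (posnP j) => [j0|j0].
  by rewrite j0 mul0r big1 // => i _; rewrite mxE j0 mul0r mulr0.
have e : (inord j.-1 : 'I_d.+1) = j.-1 :> nat.
  by rewrite inordK //; have := ltn_ord j; lia.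
rewrite (bigD1 (inord j.-1)) //= mxE e prednK // eqxx mulr1 mulrC.
rewrite big1 ?addr0 // => i ne; rewrite mxE.
rewrite (_ : _ == _ = false) ?mulr0 //; apply: contraNF ne => /eqP h.
by rewrite -val_eqE /= e h.
Qed.

Lemma mul_raise (x : 'rV[K]_d.+1) j :
  (x *m raise) 0 j = (d - j)%:R * x 0 (inord j.+1).
Proof.
rewrite mxE; case: (ltnP j d) => [jd|jd].
  have e : (inord j.+1 : 'I_d.+1) = j.+1 :> nat by rewrite inordK.
  rewrite (bigD1 (inord j.+1)) //= mxE e eqxx mulr1 mulrC.
  rewrite big1 ?addr0 // => i ne; rewrite mxE.
  rewrite (_ : _ == _ = false) ?mulr0 //; apply: contraNF ne => /eqP h.
  by rewrite -val_eqE /= e h.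
rewrite (_ : d - j = 0)%N; last by apply/eqP; rewrite subn_eq0.
rewrite mul0r big1 // => i _; rewrite mxE (_ : d - j = 0)%N ?mul0r ?mulr0 //.
by apply/eqP; rewrite subn_eq0.
Qed.

Lemma tangent_lower x : X x -> tangent_space X x (x *m lower).
Proof.
move=> /(rnc_param d0)[a [b ->]].
have h t : X (\row_(i < d.+1) (a ^+ (d - i) *: (b%:P + a *: 'X) ^+ i : {poly K}).[t]).
  rewrite (_ : \row_i _ = veronese d a (b + a * t)); first exact: rnc_veronese.
  by apply/rowP => i; rewrite !mxE !hornerE.
have := tangent_curve 0 h.
rewrite (_ : \row_i _ = veronese d a b); last first.
  by apply/rowP => i; rewrite !mxE !hornerE ?mulr0 ?addr0.
rewrite (_ : \row_i _ = veronese d a b *m lower) //; apply/rowP => i.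
rewrite mul_lower mxE derivZ deriv_exp derivD derivC derivZ derivX.
rewrite hornerZ hornerMn hornerM horner_exp !hornerE ?mulr0 ?addr0 mxE.
case: (posnP i) => [->|i0]; first by rewrite mulr0n mulr0 mul0r.
rewrite inordK; last by have := ltn_ord i; lia.
have -> : (d - i.-1 = (d - i).+1)%N by have := ltn_ord i; lia.
by rewrite exprS mulrnAr mulr_natl; congr (_ *+ _); ring.
Qed.

Lemma tangent_raise x : X x -> tangent_space X x (x *m raise).
Proof.
move=> /(rnc_param d0)[a [b ->]].
have h t : X (\row_(i < d.+1) (b ^+ i *: (a%:P + b *: 'X) ^+ (d - i) : {poly K}).[t]).
  rewrite (_ : \row_i _ = veronese d (a + b * t) b); first exact: rnc_veronese.
  by apply/rowP => i; rewrite !mxE !hornerE mulrC.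
have := tangent_curve 0 h.
rewrite (_ : \row_i _ = veronese d a b); last first.
  by apply/rowP => i; rewrite !mxE !hornerE ?mulr0 ?addr0 mulrC.
rewrite (_ : \row_i _ = veronese d a b *m raise) //; apply/rowP => i.
rewrite mul_raise mxE derivZ deriv_exp derivD derivC derivZ derivX.
rewrite hornerZ hornerMn hornerM horner_exp !hornerE ?mulr0 ?addr0 mxE.
case: (posnP (d - i)) => [->|i0]; first by rewrite mulr0n mulr0 mul0r.
rewrite inordK; last by have := ltn_ord i; lia.
have -> : (d - i.+1 = (d - i).-1)%N by have := ltn_ord i; lia.
by rewrite exprS mulrnAr mulr_natl; congr (_ *+ _); ring.
Qed.

End Fields.

(** * The critical equations along the curve *)

Section Normal.
Variables (K : numClosedFieldType) (d : nat) (M : 'M[K]_d.+1).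
Hypotheses (d0 : (0 < d)%N) (sM : M^T = M).
Local Notation Q := (form_of_matrix idfun M).
Local Notation X := (@rational_normal_cone K d).
Local Notation v := (@veronese K d 1).
Local Notation dv := (@dveronese K d).
Local Notation oo := (delta_mx 0 ord_max : 'rV[K]_d.+1).
Local Notation f := (normpoly M).
Implicit Types (u : 'rV[K]_d.+1) (c s : K).

(** The two equations say that [u - c *: v s] is orthogonal to [v s] and to
    [dv s], which span the tangent space ([affine_normalP]). *)
Definition affine_normal u c s :=
  (lpoly M u).[s] = c * f.[s] /\ (lpoly M u)^`().[s] *+ 2 = c * f^`().[s].

Lemma affine_normalP u c s :
  affine_normal u c s <->
  Q (u - c *: v s) (v s) = 0 /\ Q (u - c *: v s) (dv s) = 0.
Proof.
rewrite /affine_normal !mxformBl !mxformZl (deriv_normpoly _ sM).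
rewrite -(horner_lpoly M u) -(deriv_lpoly M u) -horner_normpoly.
split=> [[-> e]|[/eqP e1 /eqP e2]]; split; rewrite ?subrr //.
- apply/eqP; suff : ((lpoly M u)^`().[s] - c * Q (v s) (dv s)) *+ 2 == 0.
    by rewrite mulrn_eq0.
  by rewrite mulrnBl e mulrnAr subrr.
- by apply/eqP; rewrite -subr_eq0.
- by move: e2; rewrite subr_eq0 => /eqP ->; rewrite mulrnAr.
Qed.

(** Both [f] and [f^`()] are multiples of their gcd, and the cofactors cancel. *)
Lemma affine_normal_crit u c s : f != 0 -> affine_normal u c s ->
  root (critpoly f (lpoly M u)) s.
Proof.
move=> f0 [e1 e2]; rewrite /root /critpoly /jac hornerD hornerN hornerMn !hornerM.
have ef : f.[s] = (sqfree f).[s] * (gcdp f f^`()).[s] by rewrite -hornerM -sqfreeM.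
have ef' : f^`().[s] = (dlog_num f).[s] * (gcdp f f^`()).[s] by rewrite -hornerM -dlog_numM.
rewrite -mulrnAl e1 e2 ef ef'.
by apply/eqP; ring.
Qed.

Lemma crit_affine_normal u s : root (critpoly f (lpoly M u)) s -> f.[s] != 0 ->
  affine_normal u ((lpoly M u).[s] / f.[s]) s.
Proof.
move=> cs fs; split; first by rewrite divfK.
have : (jac f^`() f (lpoly M u)).[s] = 0 by rewrite jac_deriv hornerM (eqP cs) mul0r.
rewrite /jac hornerD hornerN hornerMn !hornerM => /eqP; rewrite subr_eq0 => /eqP e.
by apply: (mulIf fs); rewrite mulrAC divfK // mulrnAl -e mulrC.
Qed.

Lemma infty_jaclead u c :
  Q (u - c *: oo) oo = 0 -> Q (u - c *: oo) (delta_mx 0 (inord d.-1)) = 0 ->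
  jaclead f d (lpoly M u) = 0.
Proof.
have Qd w k : Q w (delta_mx 0 k) = (lpoly M w)`_k.
  rewrite mxformE (bigD1 k) //= big1 => [|i ne].
    by rewrite addr0 [delta_mx _ _ _ _]mxE !eqxx mulr1 /lpoly coef_rVpoly_ord.
  by rewrite [delta_mx _ _ _ _]mxE (negbTE ne) andbF mulr0.
rewrite !mxformBl !mxformZl !Qd inordK; last by rewrite ltnS leq_pred.
have oc (k : 'I_d.+1) : (lpoly M oo)`_k = M ord_max k.
  by rewrite /lpoly coef_rVpoly_ord -rowE mxE.
have -> : (lpoly M oo)`_(ord_max : 'I_d.+1) = M ord_max ord_max by rewrite oc.
have -> : (lpoly M oo)`_d.-1 = M (inord d.-1) ord_max.
  by have := oc (inord d.-1); rewrite inordK ?ltnS ?leq_pred // => ->; rewrite -[in LHS]sM mxE.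
move=> /eqP; rewrite subr_eq0 => /eqP e1 /eqP; rewrite subr_eq0 => /eqP e2.
rewrite /jaclead coef_normpoly_lead (coef_normpoly_sublead d0 sM) e1 e2.
by ring.
Qed.

(** The left-hand side is a polynomial in [(x, u)], and it vanishes on the
    critical pairs because [x *m S] is tangent at [x]. *)
Lemma ED_field (S : 'M[K]_d.+1) x u :
  (forall z, X z -> tangent_space X z (z *m S)) ->
  ED_correspondence Q X (x, u) -> Q (u - x) (x *m S) = 0.
Proof.
move=> tS; pose C := @mpolyC (d.+1 + d.+1) K.
pose yx : 'rV[{mpoly K[d.+1 + d.+1]}]_d.+1 := \row_i 'X_(lshift d.+1 i).
pose yu : 'rV[{mpoly K[d.+1 + d.+1]}]_d.+1 := \row_i 'X_(rshift d.+1 i).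
pose E := \sum_i ((yu - yx) *m map_mx C M) 0 i * (yx *m map_mx C S) 0 i.
have EE (a b : 'rV[K]_d.+1) : E.@[row_mx a b 0] = Q (b - a) (a *m S).
  have ea : map_mx (meval (row_mx a b 0)) yx = a.
    by apply/rowP => i; rewrite !mxE /= mevalXU row_mxEl.
  have eb : map_mx (meval (row_mx a b 0)) yu = b.
    by apply/rowP => i; rewrite !mxE /= mevalXU row_mxEr.
  have eC (P : 'M[K]_d.+1) : map_mx (meval (row_mx a b 0)) (map_mx C P) = P.
    by apply/matrixP => i j; rewrite !mxE /= mevalC.
  rewrite mxformE /E raddf_sum; apply: eq_bigr => i _ /=; rewrite mevalM.
  have eB : map_mx (meval (row_mx a b 0)) (yu - yx) = b - a by rewrite map_mxB ea eb.
  have ev (P : 'rV[{mpoly K[d.+1 + d.+1]}]_d.+1) :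
    (P 0 i).@[row_mx a b 0] = map_mx (meval (row_mx a b 0)) P 0 i by rewrite [RHS]mxE.
  by rewrite !ev !map_mxM !eC ea eB.
rewrite /ED_correspondence /= => /(_ E) h; rewrite -EE; apply: h.
move=> _ [[a b] /= [[Xa _] Nab] <-]; rewrite EE.
by apply: Nab; apply: tS.
Qed.

Lemma ED_rnc x u : ED_correspondence Q X (x, u) -> X x.
Proof.
move=> h; apply: (rnc_minors d0) => i j.
pose E := mmap (@mpolyC (d.+1 + d.+1) K) (fun k => 'X_(lshift d.+1 k)) (minor K i j).
have EE (a b : 'rV[K]_d.+1) : E.@[row_mx a b 0] = (minor K i j).@[a 0].
  by rewrite meval_mmapC; apply: meval_eq => k; rewrite mevalXU row_mxEl.
rewrite -(EE x u); apply: h.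
move=> _ [[a b] /= [[Xa _] _] <-]; rewrite EE.
exact: minor_vanish.
Qed.

End Normal.

(** * The ED degree of a given form *)

Section Count.
Variables (K : numClosedFieldType) (d : nat) (M : 'M[K]_d.+1).
Hypotheses (d0 : (0 < d)%N) (sM : M^T = M).
Hypothesis (uM : M \in unitmx).
Hypothesis (Mdd : M ord_max ord_max != 0).
Local Notation Q := (form_of_matrix idfun M).
Local Notation X := (@rational_normal_cone K d).
Local Notation v := (@veronese K d 1).
Local Notation dv := (@dveronese K d).
Local Notation oo := (delta_mx 0 ord_max : 'rV[K]_d.+1).
Local Notation f := (normpoly M).
Local Notation e := (ncrit f d).
Local Notation crit u := (critpoly f (lpoly M u)).
Implicit Types (u x : 'rV[K]_d.+1) (c s : K).

Let sf : size f = d.*2.+1. Proof. exact: size_normpoly. Qed.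
Let f0 : f != 0. Proof. by rewrite -size_poly_eq0 sf. Qed.

(** The critical pairs that are not at a finite nonzero point of the cone only
    occur for special [u]: at infinity and at the vertex [jaclead] vanishes. *)
Lemma normal_pair_cases x u : X x -> normal_space Q X x (u - x) ->
  jaclead f d (lpoly M u) = 0 \/
  exists c s, [/\ c != 0, x = c *: v s & affine_normal M u c s].
Proof.
move=> Xx N; have [x0|x0] := eqVneq x 0.
  left; suff -> : lpoly M u = 0 by rewrite /jaclead !coef0; ring.
  apply: poly_vanish => s; rewrite horner_lpoly.
  by have := N (v s); rewrite x0 subr0; apply; apply: tangent0.
move: Xx x0 N => /rncP[c s ->|c ->] cn N.
  have c0 : c != 0 by apply: contraNneq cn => ->; rewrite scale0r.
  right; exists c, s; split=> //; apply/(affine_normalP sM); split; apply: N.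
    exact: tangent_veronese.
  exact: tangent_dveronese.
have c0 : c != 0 by apply: contraNneq cn => ->; rewrite scale0r.
have [t1 t2] := tangent_infty d0 c0.
by left; apply: (infty_jaclead d0 sM (N _ t1) (N _ t2)).
Qed.

(** On a critical pair [(c *: v s, u)] the first coordinate of the point is [c],
    so that [s] is a common root of the critical polynomial and [x0 *: f - l];
    their Sylvester determinant vanishes.  At [x0 = 0] it is that of the critical
    polynomial and [- l], which are coprime.  Multiplying it by [jaclead] yields a
    polynomial that vanishes on the remaining critical pairs as well. *)
Lemma ED_origin u : jaclead f d (lpoly M u) != 0 ->
  coprimep (crit u) (lpoly M u) -> ~ ED_correspondence Q X (0, u).
Proof.
move=> jn cop h; pose m := (d.+1 + d.+1)%N.
pose yu : 'rV[{mpoly K[m]}]_d.+1 := \row_i 'X_(rshift d.+1 i).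
pose x0 : {mpoly K[m]} := 'X_(lshift d.+1 ord0).
pose H := gjaclead M yu * \det (sylv e d.*2 (gcrit M yu)
   (x0 *: map_poly (@mpolyC m K) f - glpoly M yu)).
have HE (a b : 'rV[K]_d.+1) : H.@[row_mx a b 0] =
    jaclead f d (lpoly M b) *
    \det (sylv e d.*2 (crit b) (a 0 ord0 *: f - lpoly M b)).
  have eb : map_mx (meval (row_mx a b 0)) yu = b.
    by apply/rowP => i; rewrite !mxE /= mevalXU row_mxEr.
  rewrite /H mevalM (meval_gjaclead _ eb) meval_sylv (map_gcrit _ eb).
  congr (_ * \det (sylv _ _ _ _)).
  by rewrite rmorphB /= (map_glpoly _ eb) map_polyZ /= mevalXU row_mxEl map_meval_C.
have H0 : H.@[row_mx 0 u 0] = 0.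
  apply: h => _ [[a b] /= [[Xa _] Nab] <-]; rewrite HE.
  case: (normal_pair_cases Xa Nab) => [->|[c [s [c0 -> an]]]]; first by rewrite mul0r.
  rewrite (@sylv_common_root _ _ _ _ _ s) ?mulr0 ?double_gt0 //.
  - by rewrite size_critpoly ?sf // size_lpoly.
  - apply: leq_trans (size_polyD _ _) _; rewrite geq_max size_polyN.
    rewrite (leq_trans (size_scale_leq _ _)) ?sf //=.
    by apply: leq_trans (size_lpoly _ _) _; lia.
  - exact: (affine_normal_crit f0 an).
  - case: an => e1 _; rewrite /root hornerD hornerN hornerZ e1.
    by rewrite mxE veroneseE expr0 mulr1 subrr.
have := H0; rewrite HE mxE scale0r sub0r => /eqP; rewrite mulf_eq0 (negbTE jn) /=.
apply/negP; apply: sylv_coprime.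
- by rewrite (size_critpoly_eq d0 sf) // size_lpoly.
- by rewrite size_polyN; apply: leq_trans (size_lpoly _ _) _; lia.
- by rewrite -scaleN1r coprimepZr ?oppr_eq0 ?oner_eq0.
Qed.

(** At [c *: v s] the vector fields [1] and [lower] are proportional to [v s] and
    [dv s], so that their equations are [affine_normal].  At infinity [1] and
    [raise] force [jaclead] to vanish. *)
Lemma ED_fiber u : jaclead f d (lpoly M u) != 0 ->
    coprimep (crit u) (lpoly M u) -> coprimep (crit u) f ->
  [set x | ED_correspondence Q X (x, u)] =
  [set ((lpoly M u).[s] / f.[s]) *: v s | s in [set s | root (crit u) s]].
Proof.
move=> jn cl cf; have fs s : root (crit u) s -> f.[s] != 0.
  by move=> cs; have := coprimep_root cf cs.
apply/seteqP; split=> [x /= Ex|_ [s /= cs <-]].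
- have Xx := ED_rnc d0 Ex.
  have E1 := ED_field (@tangent_id K d) Ex.
  have E2 := ED_field (tangent_lower d0) Ex.
  have E3 := ED_field (tangent_raise d0) Ex.
  have x0 : x != 0 by apply/negP => /eqP x0; apply: (ED_origin jn cl); rewrite -x0.
  move: Xx => /rncP[c s xE|c xE].
    have c0 : c != 0 by apply: contraNneq x0 => c0; rewrite xE c0 scale0r.
    have eS1 : x *m 1%:M = c *: v s by rewrite mulmx1.
    have eS2 : x *m lower K d = c *: dv s.
      apply/rowP => i; rewrite (mul_lower d0) xE !mxE expr1n mul1r.
      case: (posnP i) => [->|i0]; first by rewrite !mul0r mulr0.
      have hi : (i.-1 < d.+1)%N by apply: leq_ltn_trans (leq_pred _) (ltn_ord i).
      by rewrite inordK // mulrCA.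
    have an : affine_normal M u c s.
      apply/(affine_normalP sM); split; apply: (mulfI c0); rewrite mulr0 -mxformZr.
        by rewrite -{1}xE -eS1.
      by rewrite -xE -eS2.
    have cs := affine_normal_crit f0 an.
    exists s => //; case: an => -> _; rewrite mulfK ?xE //; exact: fs.
  have c0 : c != 0 by apply: contraNneq x0 => c0; rewrite xE c0 scale0r.
  case/eqP: jn; apply: (infty_jaclead d0 sM (c := c)); apply: (mulfI c0);
    rewrite mulr0 -mxformZr -xE.
    by rewrite -{2}[x]mulmx1.
  rewrite (_ : c *: _ = x *m raise K d) //; apply/rowP => i.
  rewrite mul_raise xE !mxE eqxx /= -!val_eqE /= inordK; last by rewrite ltnS leq_pred.
  case: (ltnP i d) => id; last first.
    rewrite (_ : d - i = 0)%N; last by apply/eqP; rewrite subn_eq0.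
    by rewrite mul0r (_ : (i == d.-1 :> nat) = false) ?mulr0 //; lia.
  rewrite inordK // (_ : (i.+1 == d) = (i == d.-1 :> nat)); last by lia.
  case: eqP => [->|_]; last by rewrite !mulr0.
  by rewrite (_ : d - d.-1 = 1)%N ?mul1r //; lia.
have ls : (lpoly M u).[s] != 0 by have := coprimep_root cl cs.
have c0 : (lpoly M u).[s] / f.[s] != 0 by rewrite mulf_neq0 // invr_neq0 // fs.
have [n1 n2] := (affine_normalP sM _ _ _).1 (crit_affine_normal cs (fs _ cs)).
move=> p; apply; exists ((lpoly M u).[s] / f.[s] *: v s, u) => //=; split.
  exact: rnc_smooth.
move=> w tw; rewrite (tangent_rnc_span d0 c0 tw) mxformDr !mxformZr n1 n2.
by rewrite !mulr0 addr0.
Qed.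

(** The general points are cut out by one polynomial: it detects the degree of
    the critical polynomial, through [jaclead], and its coprimality to [l], to
    [f] and to its own derivative, through a Sylvester determinant. *)
Theorem EDdegree_rnc : is_EDdegree Q X e.
Proof.
pose m := d.+1; pose y : 'rV[{mpoly K[m]}]_d.+1 := \row_i 'X_i.
pose k := (d + d.*2 + e)%N.
pose G := gjaclead M y * \det (sylv e k (gcrit M y)
   (glpoly M y * map_poly (@mpolyC m K) f * (gcrit M y)^`())).
have GE u : G.@[u 0] = jaclead f d (lpoly M u) *
    \det (sylv e k (crit u) (lpoly M u * f * (crit u)^`())).
  have yu : map_mx (meval (u 0)) y = u.
    by apply/rowP => i; rewrite !mxE /= mevalXU.
  rewrite /G mevalM (meval_gjaclead _ yu) meval_sylv !rmorphM /= -deriv_map.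
  by rewrite (map_gcrit _ yu) (map_glpoly _ yu) map_meval_C.
have sq u : (size (lpoly M u * f * (crit u)^`())%R <= k.+1)%N.
  have s1 := size_lpoly M u; have s2 := size_critpoly d0 sf s1.
  have [->|n0] := eqVneq (crit u)^`() 0; first by rewrite mulr0 size_poly0.
  apply: leq_trans (size_polyMleq _ _) _.
  have s3 : (size (lpoly M u * f)%R <= d + d.*2.+1)%N.
    apply: leq_trans (size_polyMleq _ _) _; rewrite sf addnS /=.
    by rewrite addnS -addSn leq_add2r.
  have s4 : (size (crit u)^`() <= e)%N.
    by rewrite size_num_deriv -ltnS; case: (size _) s2.
  rewrite -subn1 leq_subLR add1n /k; apply: leq_trans (leq_add s3 s4) _.
  by rewrite addnS addSn ltnW.
exists G.
  have [l sl [jl cl]] := generic_witness d0 sf.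
  exists (poly_rV l *m invmx M) => //.
  have lE : lpoly M (poly_rV l *m invmx M) = l by rewrite /lpoly mulmxKV // poly_rV_K.
  rewrite GE lE mulf_neq0 // sylv_coprime //; first exact: size_critpoly_eq.
  by have := sq (poly_rV l *m invmx M); rewrite lE.
move=> u _; rewrite GE mulf_eq0 negb_or => /andP[jn dn].
have sc : size (crit u) = e.+1 by rewrite (size_critpoly_eq d0 sf) // size_lpoly.
have c0 : crit u != 0 by rewrite -size_poly_eq0 sc.
have cop : coprimep (crit u) (lpoly M u * f * (crit u)^`()).
  apply: coprimepP_root => // s cs; apply: contra dn => qs.
  rewrite (@sylv_common_root _ _ _ _ _ s) ?sc ?sq //.
  by rewrite /k; have := d0; lia.
move: cop; rewrite !coprimepMr => /andP[/andP[cl cf] cc'].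
rewrite (ED_fiber jn cl cf).
have [rs critE] := closed_field_poly_normal (crit u).
have lc0 : lead_coef (crit u) != 0 by rewrite lead_coef_eq0.
have urs : uniq rs.
  rewrite -separable_prod_XsubC; have : separable_poly (crit u) by rewrite unlock.
  by rewrite {1}critE; apply: dvdp_separable; rewrite dvdpZr.
have rE s : root (crit u) s = (s \in rs) by rewrite critE rootZ // root_prod_XsubC.
have ers : e = size rs.
  apply: succn_inj; rewrite -sc {1}critE size_scale // size_prod_XsubC.
  by [].
pose phi s := ((lpoly M u).[s] / f.[s]) *: v s.
have phi_inj : {in rs &, injective phi}.
  move=> s t srs trs eq_st.
  have n0 r : r \in rs -> (lpoly M u).[r] / f.[r] != 0.
    rewrite -rE => cr; rewrite mulf_neq0 ?invr_neq0 //.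
      by have := coprimep_root cl cr.
    by have := coprimep_root cf cr.
  have E i := congr1 (fun w : 'rV_d.+1 => w 0 i) eq_st.
  have := E ord0; rewrite /phi mxE veroneseE mxE veroneseE !mulr1 => E0.
  have := E (ord_one d0); rewrite /phi mxE veroneseE mxE veroneseE !expr1 E0.
  by move/(mulfI (n0 _ trs)).
have -> : [set phi s | s in [set s | root (crit u) s]] = [set` map phi rs].
  apply/seteqP; split=> x /=.
    by move=> [s /=]; rewrite rE => srs <-; apply: map_f.
  by case/mapP => s srs ->; exists s => //=; rewrite rE.
rewrite ers -(size_map phi); apply: card_uniq_seq.
by rewrite map_inj_in_uniq.
Qed.

End Count.

(** * Uniqueness of general values *)

Section Unique.
Variables (K : numFieldType) (n : nat).

Definition line (w1 w2 : 'rV[K]_n) t := w1 + t *: (w2 - w1).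

Lemma mpoly_on_line (g : {mpoly K[n]}) (w1 w2 : 'rV[K]_n) :
  exists p : {poly K}, forall t, p.[t] = g.@[line w1 w2 t 0].
Proof.
exists (along (fun i => (w1 0 i)%:P + (w2 0 i - w1 0 i) *: 'X) g) => t.
rewrite alongE; apply: meval_eq => i.
by rewrite hornerD hornerC hornerZ hornerX !mxE mulrC.
Qed.

(** If [S] is stable under joining two points by a line, up to finitely many
    parameters, then two polynomials that are nonzero somewhere on [S] are both
    nonzero at some point of a line. *)
Lemma general_in_meet (S : set 'rV[K]_n) P P' :
  (forall w1 w2, S w1 -> S w2 ->
     exists2 q : {poly K}, q != 0 & forall t, q.[t] != 0 -> S (line w1 w2 t)) ->
  general_in S P -> general_in S P' -> exists u, P u /\ P' u.
Proof.
move=> hS [g [w1 S1 n1] h1] [g' [w2 S2 n2] h2].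
have [q q0 hq] := hS _ _ S1 S2.
have [p hp] := mpoly_on_line g w1 w2; have [p' hp'] := mpoly_on_line g' w1 w2.
have p0 : p != 0.
  apply: contraNneq n1 => p0; have := hp 0.
  by rewrite /line scale0r addr0 p0 horner0 => <-.
have p'0 : p' != 0.
  apply: contraNneq n2 => e0; have := hp' 1.
  by rewrite /line scale1r addrC subrK e0 horner0 => <-.
have [t] := infinite_nonroot (mulf_neq0 q0 (mulf_neq0 p0 p'0)).
rewrite !hornerM !mulf_eq0 !negb_or hp hp' => /and3P[nq ng ng'].
by exists (line w1 w2 t); split; [apply: h1|apply: h2] => //; apply: hq.
Qed.

End Unique.

Section UniqueDegree.
Variables (K : numFieldType) (n : nat).
Implicit Types (Q : 'rV[K]_n -> 'rV[K]_n -> K) (X : set 'rV[K]_n).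

Lemma is_EDdegree_inj Q X k k' :
  is_EDdegree Q X k -> is_EDdegree Q X k' -> k = k'.
Proof.
move=> h h'; have [|u [c c']] := general_in_meet _ h h'.
  by move=> *; exists 1; rewrite ?oner_neq0.
by apply/card_eq_II; rewrite -(card_eql c).
Qed.

Lemma EDdegreeE Q X k : is_EDdegree Q X k -> EDdegree Q X = k.
Proof. by move=> h; apply: xget_unique => // k' /is_EDdegree_inj; apply. Qed.

Lemma nondeg_sym_line (w1 w2 : 'rV[K]_(n * n)) :
  nondeg_sym_forms w1 -> nondeg_sym_forms w2 ->
  exists2 q : {poly K}, q != 0 &
    forall t, q.[t] != 0 -> nondeg_sym_forms (line w1 w2 t).
Proof.
move=> [M1 /= [s1 u1] <-] [M2 /= [s2 u2] <-].
pose N : 'M[{poly K}]_n := map_mx polyC M1 + 'X *: map_mx polyC (M2 - M1).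
have NE t : (\det N).[t] = \det (M1 + t *: (M2 - M1)).
  rewrite -[LHS]/(horner_eval t (\det N)) -det_map_mx; congr (\det _).
  by apply/matrixP => i j; rewrite !mxE /= /horner_eval hornerD hornerM hornerX !hornerC.
exists (\det N).
  apply/negP => /eqP e; have := NE 0; rewrite e horner0 scale0r addr0 => d1.
  by move: u1; rewrite unitmxE -d1 unitfE eqxx.
move=> t; rewrite NE => nz; exists (M1 + t *: (M2 - M1)).
  split; last by rewrite /= unitmxE unitfE.
  have T (A : 'M[K]_n) : A \is symmetricmx -> A^T = A.
    by move/is_hermitianmxP; rewrite expr0 scale1r map_mx_id // => {2}->.
  apply/is_hermitianmxP; rewrite expr0 scale1r map_mx_id //.
  by apply/matrixP => i j; rewrite -[M1 in LHS](T _ s1) -[M2 in LHS](T _ s2) !mxE.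
by rewrite /line linearD /= linearZ /= linearB.
Qed.

Lemma is_gEDdegree_inj X k k' :
  is_gEDdegree X k -> is_gEDdegree X k' -> k = k'.
Proof.
move=> h h'; have [w [c c']] := general_in_meet nondeg_sym_line h h'.
exact: is_EDdegree_inj c c'.
Qed.

Lemma gEDdegreeE X k : is_gEDdegree X k -> gEDdegree X = k.
Proof. by move=> h; apply: xget_unique => // k' /is_gEDdegree_inj; apply. Qed.

End UniqueDegree.

(** * The generic ED degree *)

Section GenericDegree.
Variables (K : numClosedFieldType) (d : nat).
Hypothesis d0 : (0 < d)%N.

(** The sum of the even powers of ['X] up to [d.*2] divides [X^(2 d + 2) - 1]. *)
Lemma separable_normpoly1 : separable_poly (@normpoly K d 1%:M).
Proof.
have E : 'X^((d.+1).*2) - 1 = ('X^2 - 1) * @normpoly K d 1%:M.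
  rewrite -mul2n exprM (subrX1 _ d.+1); congr (_ * _); apply: eq_bigr => i _.
  rewrite (bigD1 i) //= big1 => [|j ne]; last by rewrite mxE eq_sym (negbTE ne) scale0r.
  by rewrite addr0 mxE eqxx scale1r -exprD addnn -mul2n exprM.
apply: (@dvdp_separable _ ('X^((d.+1).*2) - 1)); first by rewrite E dvdp_mull.
by apply: separable_Xn_sub_1; rewrite pnatr_eq0.
Qed.

Theorem gEDdegree_rnc : is_gEDdegree (@rational_normal_cone K d) (d * 3 - 2).
Proof.
pose n := d.+1; pose m := (n * n)%N.
pose F : {poly {mpoly K[m]}} :=
  \sum_(i < n) \sum_(j < n) 'X_(mxvec_index i j) *: ('X^i * 'X^j).
have FE (w : 'rV[K]_m) : map_poly (meval (w 0)) F = normpoly (vec_mx w : 'M_n).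
  rewrite raddf_sum; apply: eq_bigr => i _; rewrite raddf_sum; apply: eq_bigr => j _ /=.
  by rewrite map_polyZ rmorphM /= !map_polyXn mevalXU mxE.
pose G := 'X_(mxvec_index ord_max ord_max) * \det (sylv d.*2 d.*2 F F^`()).
have GE (w : 'rV[K]_m) : G.@[w 0] = (vec_mx w : 'M_n) ord_max ord_max *
   \det (sylv d.*2 d.*2 (normpoly (vec_mx w : 'M_n)) (normpoly (vec_mx w : 'M_n))^`()).
  by rewrite /G mevalM mevalXU meval_sylv -deriv_map FE mxE.
have sz' (M : 'M[K]_n) : (size (normpoly M)^`() <= d.*2.+1)%N.
  rewrite size_num_deriv; apply: leq_trans (leq_pred _) _; exact: size_normpoly_le.
exists G.
  have M1 : (1%:M : 'M[K]_n) ord_max ord_max = 1 by rewrite mxE eqxx.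
  exists (mxvec 1%:M).
    exists 1%:M => //; split; last exact: unitmx1.
    by apply/is_hermitianmxP; rewrite expr0 scale1r map_mx_id // trmx1.
  rewrite GE mxvecK M1 mul1r sylv_coprime ?sz' //.
    by rewrite size_normpoly // M1 oner_neq0.
  by have := separable_normpoly1; rewrite unlock.
move=> w [M /= [sM uM] <-]; rewrite GE mxvecK mulf_eq0 negb_or => /andP[Mdd dn].
have sM' : M^T = M.
  by move/is_hermitianmxP: sM; rewrite expr0 scale1r map_mx_id // => {2}->.
have sf := size_normpoly Mdd.
have cop : coprimep (normpoly M) (normpoly M)^`().
  apply: coprimepP_root; first by rewrite -size_poly_eq0 sf.
  move=> s fs; apply: contra dn => f's.
  by rewrite (@sylv_common_root _ _ _ _ _ s) ?sf ?sz' // double_gt0.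
have := EDdegree_rnc d0 sM' uM Mdd.
have -> : ncrit (normpoly M) d = (d * 3 - 2)%N.
  have sg : size (gcdp (normpoly M) (normpoly M)^`()) = 1%N by apply/eqP.
  have e : (size (sqfree (normpoly M)) + 1 = d.*2.+2)%N.
    by rewrite -{1}sg; apply: size_sqfree_gcdp.
  by rewrite /ncrit; lia.
by [].
Qed.

End GenericDegree.

(** * Roots in conjugate pairs *)

(** Conjugation exchanges the elements in the upper and the lower half plane. *)
Lemma conj_closed_even (K : numClosedFieldType) (s : seq K) :
  uniq s -> {in s, forall z, z^* \in s} -> {in s, forall z, z \isn't Num.real} ->
  ~~ odd (size s).
Proof.
move=> us sc sr; pose pos (z : K) := 0 < 'Im z.
have Im0 z : z \in s -> 'Im z != 0.
  by move=> zs; apply: contra (sr _ zs) => /eqP/Creal_ImP.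
have posC z : z \in s -> pos z^* = ~~ pos z.
  move=> zs; rewrite /pos Im_conj oppr_gt0 -real_leNgt ?Creal_Im ?real0 //.
  by rewrite lt_neqAle Im0.
have pe : perm_eq (map (@Num.conj K) (filter pos s)) (filter (predC pos) s).
  apply: uniq_perm.
  - by rewrite map_inj_uniq ?filter_uniq //; apply: can_inj; apply: conjCK.
  - exact: filter_uniq.
  move=> z; rewrite mem_filter; apply/mapP/andP => [[y]|[pz zs]].
    by rewrite mem_filter => /andP[py ys] ->; rewrite /= posC // py sc.
  exists z^*; last by rewrite conjCK.
  by rewrite mem_filter posC // sc // andbT.
have := perm_size pe; rewrite size_map !size_filter => e.
by rewrite -(count_predC pos) -e addnn odd_double.
Qed.

(** * Positive definite forms *)

Section Positive.
Variables (R : realType) (d : nat).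
Hypothesis d0 : (0 < d)%N.
Variable N : 'M[R]_d.+1.
Hypotheses (sN : N^T = N) (pN : posdefmx N).
Local Notation M := (map_mx (real_complex R) N).
Local Notation f := (normpoly M).

Lemma posdef_diag i : 0 < N i i.
Proof.
have := pN (x := delta_mx 0 i); rewrite -rowE trmx_delta -colE !mxE; apply.
by apply/negP => /eqP/rowP/(_ i)/eqP; rewrite !mxE !eqxx oner_eq0.
Qed.

Lemma posdef_unit : N \in unitmx.
Proof.
rewrite unitmxE unitfE; apply/negP => /eqP/eqP/det0P[x x0 xN].
by have := pN x0; rewrite xN mul0mx mxE ltxx.
Qed.

Lemma normpoly_conj s : f.[s^*] = f.[s]^*.
Proof.
rewrite /normpoly !horner_sum rmorph_sum; apply: eq_bigr => i _ /=.
rewrite !horner_sum rmorph_sum; apply: eq_bigr => j _ /=.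
rewrite !hornerZ !hornerM !hornerXn !rmorphM !rmorphXn /=; congr (_ * _).
by rewrite mxE conj_Creal //; apply/complex_realP; exists (N i j).
Qed.

(** At a real parameter the value is that of the form at a nonzero real vector. *)
Lemma normpoly_real_root s : s \is Num.real -> ~~ root f s.
Proof.
move=> /complex_realP[r ->]; apply/negP => /eqP.
pose x : 'rV[R]_d.+1 := \row_i r ^+ i.
have -> : f.[r%:C%C] = ((x *m N *m x^T) 0 0)%:C%C.
  rewrite horner_normpoly mxformE mxE rmorph_sum; apply: eq_bigr => j _ /=.
  rewrite rmorphM !mxE; congr (_ * _); last by rewrite expr1n mul1r rmorphXn.
  rewrite rmorph_sum; apply: eq_bigr => i _ /=.
  by rewrite rmorphM !mxE expr1n mul1r rmorphXn.
have x0 : x != 0.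
  by apply/negP => /eqP/rowP/(_ ord0)/eqP; rewrite !mxE expr0 oner_eq0.
by have := pN x0 => h /complexI e; move: h; rewrite e ltxx.
Qed.

Lemma posdef_size_sqfree : odd (size (sqfree f)).
Proof.
have Mdd : M ord_max ord_max != 0.
  by rewrite mxE fmorph_eq0 gt_eqF // posdef_diag.
have sf := size_normpoly Mdd.
have f0 : f != 0 by rewrite -size_poly_eq0 sf.
have [rs wE] := closed_field_poly_normal (sqfree f).
have w0 : sqfree f != 0 by apply: contraNneq f0 => w0; rewrite [f]sqfreeM w0 mul0r.
have lc0 : lead_coef (sqfree f) != 0 by rewrite lead_coef_eq0.
have urs : uniq rs.
  rewrite -separable_prod_XsubC; have := make_separable f0.
  by rewrite -/(sqfree f) {1}wE; apply: dvdp_separable; rewrite dvdpZr.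
have rE s : (s \in rs) = root f s.
  by rewrite -root_sqfree // wE rootZ // root_prod_XsubC.
rewrite wE size_scale // size_prod_XsubC /=; apply: conj_closed_even => // z.
  by rewrite !rE /root normpoly_conj conjC_eq0.
by rewrite rE => fz; apply/negP => /normpoly_real_root; rewrite fz.
Qed.

End Positive.

Theorem proposition5p8 (R : realType) (d : nat) (hd : (1 <= d)%N)
    (Q : {symmetric 'rV[R]_d.+1}) (hQ : nondegenerate Q) :
  let defect := EDdefect (complexify Q) (@rational_normal_cone R[i] d) in
  (posdefmx (matrix_of_form Q) -> (2 %| defect)%Z) /\
  ((2 * d)%:Z - 1 <= defect -> ~ posdefmx (matrix_of_form Q)).
Proof.
set N := matrix_of_form Q.
(* r is half the number of roots of f *)
suff key : posdefmx N -> exists2 r : nat, (1 <= r)%N &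
    EDdefect (complexify Q) (@rational_normal_cone R[i] d) = (d%:Z - r%:Z) * 2.
  split=> [/key[r _ ->]|le /key[r r1 e]]; first by rewrite dvdz_mull.
  by move: le; rewrite e; lia.
move=> pN.
have sN : N^T = N.
  by apply/matrixP => i j; rewrite !mxE hermC expr0 mul1r.
pose M := map_mx (real_complex R) N.
have sM : M^T = M by rewrite map_trmx sN.
have uM : M \in unitmx by rewrite map_unitmx posdef_unit.
have Mdd : M ord_max ord_max != 0 by rewrite mxE fmorph_eq0 gt_eqF // posdef_diag.
have sf := size_normpoly Mdd.
have dE := EDdegreeE (EDdegree_rnc hd sM uM Mdd).
have gE := gEDdegreeE (gEDdegree_rnc R[i] hd).
have w1 := size_sqfree_gt1 hd sf.
have wodd := posdef_size_sqfree pN.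
have wE : size (sqfree (normpoly M)) = ((size (sqfree (normpoly M)))./2).*2.+1.
  by rewrite -[LHS]odd_double_half wodd.
exists (size (sqfree (normpoly M)))./2.
  by rewrite half_gt0.
rewrite /EDdefect gE [EDdegree _ _]dE /ncrit wE.
rewrite wE in w1; move: (_./2) w1 => r w1.
by lia.
Qed.
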